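(* Let $d$ be a positive integer and let $\mathcal{F}:\mathcal{P}(\mathbb{S}^{d-1})\to\mathbb{R}^{d\times d}$ be such that there is a constant $L_{\mathcal{F}}\ge 0$ with $\|\mathcal{F}[\varrho]-\mathcal{F}[\widetilde\varrho]\|_{\mathrm{op}}\le L_{\mathcal{F}}W_1(\varrho,\widetilde\varrho)$ for all $\varrho,\widetilde\varrho\in\mathcal{P}(\mathbb{S}^{d-1})$, and such that $\mathrm{tr}(\mathcal{F}[\varrho])=0$ for all $\varrho\in\mathcal{P}(\mathbb{S}^{d-1})$. Let $\rho(t)$ be the solution of the mean-field dynamics $$\partial_t\rho+\operatorname{div}_{\mathbb{S}^{d-1}}(b(\cdot,\rho)\rho)=0,\qquad \rho(0)=\rho_0,\qquad b(x,\varrho):=(I_d-xx^{\top})\mathcal{F}[\varrho]x.$$ Assume that $\rho_0=\mathrm{ACG}(\Sigma_0)$ for some $\Sigma_0\in\mathrm{SPD}_1(d)$. Then, for all $t\ge0$, $$\rho(t)=\mathrm{ACG}(\Sigma(t)),$$ where $\Sigma:[0,\infty)\to\mathrm{SPD}_1(d)$ solves $$\dot\Sigma(t)=\mathcal{F}[p_{\Sigma(t)}]\,\Sigma(t)+\Sigma(t)\,\mathcal{F}[p_{\Sigma(t)}]^{\top},\qquad \Sigma(0)=\Sigma_0.$$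
   Context: $\mathbb{S}^{d-1}$ is the unit sphere in $\mathbb{R}^d$ with the Euclidean norm $\|\cdot\|$; $\|\cdot\|_{\mathrm{op}}$ is the matrix operator norm; $\mathcal{P}(\mathbb{S}^{d-1})$ is the set of (Borel) probability measures on $\mathbb{S}^{d-1}$, equipped with the Wasserstein-1 distance $W_1$ induced by the Euclidean distance. Angular central Gaussian distribution: for $\Sigma\in\mathbb{R}^{d\times d}$ symmetric positive definite, $\mathrm{ACG}(\Sigma)$ is the law of $Y/\|Y\|$ where $Y\sim\mathcal{N}(0,\Sigma)$ is a centered Gaussian vector in $\mathbb{R}^d$. It has density $p_\Sigma(x)=\frac{\Gamma(d/2)}{2\pi^{d/2}}\frac{1}{\sqrt{\det\Sigma}}(x^{\top}\Sigma^{-1}x)^{-d/2}$ with respect to surface measure on $\mathbb{S}^{d-1}$; $p_\Sigma$ and $\mathrm{ACG}(\Sigma)$ are used interchangeably, so $\mathcal{F}[p_\Sigma]=\mathcal{F}[\mathrm{ACG}(\Sigma)]$. $\mathrm{SPD}_1(d):=\{\Sigma\in\mathbb{R}^{d\times d}:\Sigma=\Sigma^{\top},\ \Sigma\succ0,\ \det\Sigma=1\}$. The solution of the mean-field equation means the unique weak solution: a curve $\rho\in C([0,\infty);\mathcal{P}(\mathbb{S}^{d-1}))$ (continuous for $W_1$) with $\rho(0)=\rho_0$ such that, for every $\varphi\in C^1(\mathbb{S}^{d-1})$ and every $t\ge0$, $$\int\varphi(x)\,d\rho(t,x)-\int\varphi(x)\,d\rho_0(x)=\int_0^t\int\nabla_{\mathbb{S}^{d-1}}\varphi(x)^{\top}b(x,\rho(s))\,d\rho(s,x)\,ds,$$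 where integrals in $x$ are over $\mathbb{S}^{d-1}$ and $\nabla_{\mathbb{S}^{d-1}}$ is the spherical gradient viewed as a tangent vector in $\mathbb{R}^d$. *)

(* Defs.v *)
From HB Require Import structures.
From mathcomp Require Import all_boot all_order all_algebra.
From mathcomp Require Import all_classical all_reals all_analysis.
From mathcomp Require Import measurable_realfun giry.

Set Implicit Arguments.
Unset Strict Implicit.
Unset Printing Implicit Defensive.

Import Order.TTheory GRing.Theory Num.Theory.
Import numFieldNormedType.Exports.

Local Open Scope classical_set_scope.
Local Open Scope ring_scope.

Section euclidean.
Context {R : realType}.

(* The library norm on matrices is the sup norm, hence a separate name for the
   Euclidean one; both induce the same topology. *)
Definition enorm n (x : 'cV[R]_n) : R := Num.sqrt (\sum_i x i ord0 ^+ 2).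

Definition qform n (A : 'M[R]_n) (x : 'cV[R]_n) : R :=
  (x^T *m A *m x) ord0 ord0.

Definition SPD1 n : set 'M[R]_n :=
  [set A | [/\ A^T = A, forall x, x != 0 -> 0 < qform A x & \det A = 1]].

Definition grad n (f : 'cV[R]_n -> R) (x : 'cV[R]_n) : 'cV[R]_n :=
  \col_i 'D_(delta_mx i ord0) f x.

Lemma enorm0 n : enorm (0 : 'cV[R]_n) = 0.
Proof.
by rewrite /enorm big1 ?sqrtr0// => i _; rewrite mxE expr0n.
Qed.

Lemma enorm_eq0 n (x : 'cV[R]_n) : (enorm x == 0) = (x == 0).
Proof.
apply/idP/idP => [|/eqP ->]; last by rewrite enorm0.
rewrite sqrtr_eq0 => x0; apply/eqP/colP => i; rewrite mxE; apply/eqP.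
have s0 : \sum_i x i ord0 ^+ 2 = 0.
  by apply/eqP; rewrite eq_le x0/= sumr_ge0// => j _; exact: sqr_ge0.
rewrite -sqrf_eq0; apply/eqP.
by move/psumr_eq0P : s0; apply => // j _; exact: sqr_ge0.
Qed.

Lemma enormZ n (c : R) (x : 'cV[R]_n) : enorm (c *: x) = `|c| * enorm x.
Proof.
rewrite /enorm (eq_bigr (fun i => c ^+ 2 * x i ord0 ^+ 2)); last first.
  by move=> i _; rewrite mxE exprMn.
by rewrite -mulr_sumr sqrtrM ?sqr_ge0// sqrtr_sqr.
Qed.

Lemma enorm_normalized n (x : 'cV[R]_n) :
  x != 0 -> enorm ((enorm x)^-1 *: x) = 1.
Proof.
move=> x0; rewrite enormZ ger0_norm ?invr_ge0 ?sqrtr_ge0//.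
by rewrite mulVf// enorm_eq0.
Qed.

End euclidean.

Definition usphere (R : realType) n : set 'cV[R]_n := [set x | enorm x = 1].
Arguments usphere R n : clear implicits.

Definition opnorm (R : realType) n (A : 'M[R]_n) : R :=
  sup [set enorm (A *m x) | x in usphere R n].

(* The sphere S^n of R^(n+1) as a type; its topology is the trace of that of
   R^(n+1), and [measurable] is its Borel sigma-algebra. *)
Definition sphere (R : realType) n : Type := set_type (usphere R n.+1).

HB.instance Definition _ (R : realType) n :=
  Topological.copy (sphere R n) (set_type (usphere R n.+1)).

HB.instance Definition _ (R : realType) n :=
  SubChoice.copy (sphere R n) (set_type (usphere R n.+1)).

Lemma usphere_delta (R : realType) n :
  (delta_mx ord0 ord0 : 'cV[R]_n.+1) \in usphere R n.+1.
Proof.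
apply/mem_set; rewrite /usphere/= /enorm (bigD1 ord0)//= big1 => [|i i0].
  by rewrite mxE/= addr0 expr1n sqrtr1.
by rewrite mxE (negbTE i0) expr0n.
Qed.

HB.instance Definition _ (R : realType) n := isPointed.Build (sphere R n)
  (exist _ (delta_mx ord0 ord0) (usphere_delta R n)).

HB.instance Definition _ (R : realType) n :=
  @isMeasurable.Build (sigma_display (@open (sphere R n))) (sphere R n)
    <<s @open (sphere R n) >>
    (@sigma_algebra0 _ setT _) (@sigma_algebraC _ _)
    (@sigma_algebra_bigcup _ setT _).

Definition bvec (R : realType) n := g_sigma_algebraType (@open 'cV[R]_n).

Section measurability.
Context {R : realType}.

Lemma measurable_open_preimage d (T : measurableType d) n (f : T -> 'cV[R]_n) :
  (forall i, measurable_fun setT (fun t => f t i ord0 : measurableTypeR R)) ->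
  forall U, open U -> measurable (f @^-1` U).
Proof.
move=> mf U oU.
pose B (p : 'cV[rat]_n * nat) :=
  [set v : 'cV[R]_n | forall i, `|ratr (p.1 i ord0) - v i ord0| < p.2.+1%:R^-1].
have -> : f @^-1` U = \bigcup_(p in [set p | B p `<=` U]) (f @^-1` B p).
  apply/seteqP; split => [t Ut|t [p Bp Bt]]; last exact: Bp.
  move: oU; rewrite openE => /(_ _ Ut) /nbhs_ballP[e /= e0 eU].
  have e20 : 0 < e / 2 by rewrite divr_gt0.
  have [k _ /(_ k (leqnn k)) /= ke] := near_infty_natSinv_lt (PosNum e20).
  have k0 : 0 < k.+1%:R^-1 :> R by rewrite invr_gt0.
  have /choice[q qP] : forall i, exists r : rat,
      `|ratr r - f t i ord0| < k.+1%:R^-1.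
    move=> i; have : f t i ord0 - k.+1%:R^-1 < f t i ord0 + k.+1%:R^-1.
      by rewrite ltrBlDr -addrA ltrDl addr_gt0.
    move=> /rat_in_itvoo[r]; rewrite in_itv/= => /andP[r1 r2].
    by exists r; rewrite ltr_distl r1.
  exists (\col_i q i, k) => /=; last by rewrite /B/= => i; rewrite mxE.
  move=> v; rewrite /B/= => Bv; apply: eU; split => // i j.
  rewrite (ord1 j) /ball/= [_ i ord0 - _](_ : _ =
    (f t i ord0 - ratr (q i)) + (ratr (q i) - v i ord0)); last first.
    by rewrite addrA subrK.
  apply: (le_lt_trans (ler_normD _ _)); rewrite (splitr e) ltrD//.
    by rewrite distrC (lt_trans (qP i)).
  by have := Bv i; rewrite mxE => /lt_trans; exact.
rewrite bigcup_mkcond; apply: countable_bigcupT_measurable => [//|p].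
case: ifPn => // _.
have -> : f @^-1` B p = \bigcap_(i in [set: 'I_n])
    ((fun t => f t i ord0) @^-1`
       [set x : R | `|ratr (p.1 i ord0) - x| < p.2.+1%:R^-1]).
  by apply/seteqP; split => [t Bt i _|t Bt i]; [exact: Bt|exact: (Bt i)].
apply: fin_bigcap_measurable => // i _.
rewrite -[X in measurable X]setTI; apply: mf => //.
rewrite (_ : [set x : R | _] = ball (ratr (p.1 i ord0) : R) p.2.+1%:R^-1)//.
by apply: open_measurable; apply: ball_open.
Qed.

Lemma measurable_bvec d (T : measurableType d) n (f : T -> bvec R n) :
  (forall i, measurable_fun setT
     (fun t => (f t : 'cV_n) i ord0 : measurableTypeR R)) ->
  measurable_fun setT f.
Proof.
move=> mf; apply: (@measurability _ _ T (bvec R n) _ f (@open 'cV[R]_n)) => //.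
by move=> _ [U oU <-]; rewrite setTI; exact: measurable_open_preimage.
Qed.

Lemma measurable_sphere d (T : measurableType d) n (f : T -> sphere R n) :
  (forall i, measurable_fun setT
     (fun t => (val (f t) : 'cV_n.+1) i ord0 : measurableTypeR R)) ->
  measurable_fun setT f.
Proof.
move=> mf; apply: (@measurability _ _ T (sphere R n) _ f (@open (sphere R n))) => //.
move=> _ [_ [V oV <-] <-]; rewrite setTI -comp_preimage.
exact: measurable_open_preimage.
Qed.

Lemma measurable_bvec_coord n (i : 'I_n) :
  measurable_fun setT (fun x : bvec R n => (x : 'cV_n) i ord0 : measurableTypeR R).
Proof.
apply: (measurability _ (RGenOpens.measurableE R)).
move=> _ [_ [a [b ->] <-]]; rewrite setTI; apply: sub_sigma_algebra.
have /continuousP := @coord_continuous R n 1 i ord0.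
by apply; exact: interval_open.
Qed.

Lemma measurable_enorm n : measurable_fun setT
  (fun x : bvec R n => enorm x : measurableTypeR R).
Proof.
apply: (@measurableT_comp _ _ _ _ _ _ (@Num.sqrt R : measurableTypeR R -> _)).
  by apply: continuous_measurable_fun; exact: sqrt_continuous.
apply: measurable_sum => i; apply: measurable_funX.
exact: measurable_bvec_coord.
Qed.

End measurability.

(* x / ||x||; the value at 0 is an arbitrary point of the sphere. *)
Definition normalize {R : realType} {n} (x : bvec R n.+1) : sphere R n :=
  insubd (point : sphere R n) ((enorm x)^-1 *: (x : 'cV_n.+1)).

Lemma val_normalize (R : realType) n (x : 'cV[R]_n.+1) : val (normalize x) =
  if x == 0 then delta_mx ord0 ord0 else (enorm x)^-1 *: x.
Proof.
rewrite /normalize val_insubd; case: ifPn => [|]; have [->|x0] := eqVneq x 0 => //.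
- rewrite scaler0 => /set_mem; rewrite /usphere/= enorm0 => /eqP.
  by rewrite eq_sym oner_eq0.
- by move=> /negP[]; apply/mem_set; exact: enorm_normalized.
Qed.

Lemma measurable_normalize (R : realType) n :
  measurable_fun setT (@normalize R n).
Proof.
apply: measurable_sphere => i.
rewrite (_ : (fun _ => _) = fun x : bvec R n.+1 =>
  if enorm x == 0 then (delta_mx ord0 ord0 : 'cV[R]_n.+1) i ord0
  else enorm x `^ (-1) * (x : 'cV_n.+1) i ord0); last first.
  apply/funext => x; rewrite val_normalize enorm_eq0; case: ifPn => // _.
  by rewrite mxE powR_inv1// sqrtr_ge0.
apply: measurable_fun_ifT => //.
  by apply: measurable_fun_eqr => //; exact: measurable_enorm.
apply: measurable_funM; last exact: measurable_bvec_coord.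
apply: (@measurableT_comp _ _ _ _ _ _ (fun y : measurableTypeR R => y `^ (-1))).
  exact: measurable_powR.
exact: measurable_enorm.
Qed.

HB.instance Definition _ (R : realType) n :=
  isMeasurableFun.Build _ _ _ _ _ (@measurable_normalize R n).

Section gaussian.
Context {R : realType}.

Definition tcons n (p : measurableTypeR R * n.-tuple (measurableTypeR R)) :
  n.+1.-tuple (measurableTypeR R) := [tuple of p.1 :: p.2].

Lemma measurable_tcons n : measurable_fun setT (@tcons n).
Proof. by apply: measurable_cons. Qed.

HB.instance Definition _ n :=
  isMeasurableFun.Build _ _ _ _ _ (@measurable_tcons n).

(* law of n independent standard normal variables *)
Fixpoint std_normal n : probability (n.-tuple (measurableTypeR R)) R :=
  if n is m.+1 then distribution (normal_prob 0 1 \x std_normal m)%E (@tcons m)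
  else dirac [tuple].

Definition linear_image n (A : 'M[R]_n) (z : n.-tuple (measurableTypeR R)) :
  bvec R n := A *m (\col_i tnth z i).

Lemma measurable_linear_image n (A : 'M[R]_n) :
  measurable_fun setT (linear_image A).
Proof.
apply: measurable_bvec => i.
rewrite (_ : (fun _ => _) = fun z : n.-tuple (measurableTypeR R) =>
  \sum_j A i j * (tnth z j : R)); last first.
  by apply/funext => z; rewrite mxE; apply: eq_bigr => j _; rewrite mxE.
apply: measurable_sum => j; apply: measurable_funM => //.
exact: measurable_tnth.
Qed.

HB.instance Definition _ n (A : 'M[R]_n) :=
  isMeasurableFun.Build _ _ _ _ _ (measurable_linear_image A).

(* N(0, S) is the law of A Z, where Z has independent standard normal entries
   and A A^T = S.  The law does not depend on the choice of such an A, which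
   exists for every positive definite S. *)
Definition gaussian n (S : 'M[R]_n) : probability (bvec R n) R :=
  distribution (std_normal n) (linear_image (xget 0 [set A | A *m A^T = S])).

Definition ACG n (S : 'M[R]_n.+1) : probability (sphere R n) R :=
  distribution (gaussian S) normalize.

End gaussian.

Section wasserstein.
Context {R : realType} {n : nat}.
Implicit Types mu nu : probability (sphere R n) R.

Definition coupling mu nu (pi : probability (sphere R n * sphere R n)%type R) :=
  (forall A, measurable A -> pi (A `*` setT) = mu A) /\
  (forall B, measurable B -> pi (setT `*` B) = nu B).

Definition W1 mu nu : \bar R :=
  ereal_inf [set (\int[pi]_z (enorm (val z.1 - val z.2))%:E)%E |
    pi in coupling mu nu].

End wasserstein.

Section sphere_calculus.
Context {R : realType} {n : nat}.
Implicit Types phi : sphere R n -> R.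

(* extension of phi to R^(n+1) minus the origin that is constant on rays *)
Definition radial_ext phi (x : 'cV[R]_n.+1) : R := phi (normalize x).

Definition C1_sphere phi := forall x : 'cV[R]_n.+1, x != 0 ->
  differentiable (radial_ext phi) x /\
  {for x, continuous (grad (radial_ext phi))}.

(* The spherical gradient is the tangential part of the gradient of any local
   C^1 extension; that of the radial extension is already tangential. *)
Definition sphere_grad phi (x : sphere R n) : 'cV[R]_n.+1 :=
  grad (radial_ext phi) (val x).

End sphere_calculus.

Section mean_field.
Context {R : realType} {n : nat}.
Variable F : probability (sphere R n) R -> 'M[R]_n.+1.

Definition drift (x : 'cV[R]_n.+1) (mu : probability (sphere R n) R) :
  'cV[R]_n.+1 := (1%:M - x *m x^T) *m F mu *m x.

(* Curves on [0, +oo) are functions on R of which only the values at t >= 0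
   matter. *)
Definition W1_continuous (rho : R -> probability (sphere R n) R) :=
  forall t, 0 <= t ->
    W1 (rho s) (rho t) @[s --> within [set s | 0 <= s] (nbhs t)] --> 0%E.

Definition weak_solution (rho0 : probability (sphere R n) R)
    (rho : R -> probability (sphere R n) R) :=
  [/\ W1_continuous rho,
      rho 0 ≡μ rho0 &
      forall phi, C1_sphere phi -> forall t, 0 <= t ->
        \int[rho t]_x phi x - \int[rho0]_x phi x =
        \int[lebesgue_measure]_(s in `[0, t]) (\int[rho s]_x
          ((sphere_grad phi x)^T *m drift (val x) (rho s)) ord0 ord0)].

Definition ACG_ode (Sigma : R -> 'M[R]_n.+1) :=
  forall t, 0 <= t ->
    (s - t)^-1 *: (Sigma s - Sigma t) @[s --> within [set s | 0 <= s] t^'] -->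
    F (ACG (Sigma t)) *m Sigma t + Sigma t *m (F (ACG (Sigma t)))^T.

End mean_field.

(* Main.v *)
(** Freeze the coefficient A t := F (rho t), which is continuous in t since F is
    Lipschitz for W1, and let G be the flow of the linear equation G' = A G.  The
    projective action v |-> G t v / |G t v| of this flow on the sphere is generated
    by the field x |-> (1 - x x^T) A t x.  Hence, for a C^1 function phi, the integral of
    v |-> phi (G t^-1 v / |G t^-1 v|) against rho t has zero derivative: the weak
    formulation of the continuity equation and the derivative of the pulled-back test
    function cancel.  So rho t is the image of ACG Sigma0 under the projective
    action of G t, which is ACG (G t Sigma0 (G t)^T) because the standard
    Gaussian law is invariant under orthogonal maps; det G t = 1 by Liouville's
    formula.

    C^1 functions on the sphere determine measures: exp (- sum_i exp (k - k^2 (x_i - a_i)))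
    tends to the indicator of the orthant {x | a_i < x_i for all i}. *)

Require Import Defs.
From HB Require Import structures.
From mathcomp Require Import all_boot all_order all_algebra.
From mathcomp Require Import all_classical all_reals all_analysis.
From mathcomp Require Import measurable_realfun giry.
From mathcomp Require Import ring lra perm.

Import Order.TTheory GRing.Theory Num.Theory.
Import numFieldNormedType.Exports.
Import Radon_Nikodym_SigmaFinite.

Set Implicit Arguments.
Unset Strict Implicit.
Unset Printing Implicit Defensive.

Local Open Scope classical_set_scope.
Local Open Scope ring_scope.

(** [Sigma] is read off from the given [rho] through a linear equation. The nonlinear equation comes
    back only at the end, because [F], being Lipschitz for [W1], takes equal values on measures that
    agree on all measurable sets.

    The obstacle in the cancellation is that the weak formulation admits only test functions fixed
    in time, whereas the pulled-back one moves with the flow. The increment of t |-> int f_t d(rho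
    t) is therefore split in two: rho moves under a fixed f_s, which the weak formulation covers,
    and the difference quotient of f is integrated against the moving measure. The second limit
    rests on the continuity of t |-> int Phi_t d(rho t), while [W1] directly controls Lipschitz
    integrands only. An affine modulus |Phi v - Phi w| <= e + C |v - w|, available for every
    continuous function on the compact sphere, closes this gap.

    Curves are given for t >= 0 only. They are extended by their value at 0, so that continuity can
    be stated on the whole line. *)

(** * Integrals against Lebesgue measure and the normal law *)

Lemma ge0_integral_normal_prob (R : realType) (m s : R) (f : measurableTypeR R -> \bar R) :
  measurable_fun [set: measurableTypeR R] f -> (forall x, 0 <= f x)%E ->
  (\int[normal_prob m s]_x f x =
   \int[lebesgue_measure]_x (f x * (normal_pdf m s x)%:E))%E.
Proof.
move=> mf f0.
have dom := normal_prob_dominates m s.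
rewrite -(change_of_variables dom)//.
have mrn := measurable_int _ (f_integrable dom).
have mp : measurable_fun [set: measurableTypeR R] (fun x => (normal_pdf m s x)%:E).
  by apply/measurable_EFinP; exact: measurable_normal_pdf.
apply: ge0_ae_eq_integral => //.
- exact: emeasurable_funM.
- exact: emeasurable_funM.
- by move=> x _; rewrite mule_ge0// f_ge0.
- by move=> x _; rewrite mule_ge0// lee_fin normal_pdf_ge0.
(* The Radon-Nikodym derivative and [normal_pdf] agree almost everywhere because they have the same
   integral over every measurable set. *)
apply: ae_eqe_mul2l.
apply: integral_ae_eq => //.
  exact: f_integrable.
by move=> E _ mE; rewrite -f_integral.
Qed.

Lemma measurable_addr (R : realType) (a : R) :
  measurable_fun [set: measurableTypeR R]
    (fun x : measurableTypeR R => (x + a : measurableTypeR R)).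
Proof. exact: measurable_funD. Qed.

Lemma lebesgue_measure_shift (R : realType) (a : R)
    (A : set (measurableTypeR R)) : measurable A ->
  pushforward lebesgue_measure
    (fun x : measurableTypeR R => (x + a : measurableTypeR R)) A =
  lebesgue_measure A.
Proof.
move=> mA.
pose g : {mfun measurableTypeR R >-> measurableTypeR R} :=
  HB.pack (fun x : measurableTypeR R => (x + a : measurableTypeR R))
    (isMeasurableFun.Build _ _ _ _ _ (measurable_addr a)).
apply/esym/(@lebesgue_measure_unique R (pushforward lebesgue_measure g)) => //= _ [[b c]] _ <-.
rewrite /pushforward/= (_ : _ @^-1` _ = `]b - a, c - a]%classic); last first.
  by apply/seteqP; split => x /=; rewrite !in_itv/= ltrBlDr lerBrDr.
rewrite !lebesgue_measure_itv/= !lte_fin ltrD2r; case: ifPn => // _.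
by rewrite -!EFinB opprD addrACA subrr addr0.
Qed.

Lemma ge0_integral_shift (R : realType) (a : R) (f : measurableTypeR R -> \bar R) :
  measurable_fun [set: measurableTypeR R] f -> (forall x, 0 <= f x)%E ->
  (\int[lebesgue_measure]_x f (x + a)%R = \int[lebesgue_measure]_x f x)%E.
Proof.
move=> mf f0.
rewrite -[LHS](ge0_integral_pushforward (measurable_addr a) _ measurableT)//.
apply: eq_measure_integral => [|mA' A mA _]; first exact: measurable_addr.
exact: lebesgue_measure_shift.
Qed.

(** The density is even and Lebesgue measure is invariant under x |-> -x. This serves the
    one-dimensional case Q = -1 of orthogonal invariance. *)
Lemma ge0_integral_normal_probN (R : realType) (f : measurableTypeR R -> \bar R) :
  measurable_fun [set: measurableTypeR R] f -> (forall x, 0 <= f x)%E ->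
  (\int[normal_prob 0 1]_x f (- x)%R = \int[normal_prob 0 1]_x f x)%E.
Proof.
move=> mf f0.
have mN : measurable_fun [set: measurableTypeR R] (fun x => f (- x)).
  exact: (measurableT_comp mf).
have mp : measurable_fun [set: measurableTypeR R]
    (fun x => (normal_pdf 0 1 x)%:E).
  by apply/measurable_EFinP; exact: measurable_normal_pdf.
rewrite !ge0_integral_normal_prob//.
rewrite [RHS](_ : _ = (\int[pushforward lebesgue_measure
    (-%R : measurableTypeR R -> measurableTypeR R)]_x
    (f x * (normal_pdf 0 1 x)%:E))%E); last first.
  by apply: eq_measure_integral => A mA _; rewrite [RHS]lebesgue_measureN.
have mfp : measurable_fun [set: measurableTypeR R]
    (fun x => (f x * (normal_pdf 0 1 x)%:E)%E) by exact: emeasurable_funM.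
rewrite (ge0_integral_pushforward _ _ measurableT mfp) => [|//|x _]; last first.
  by rewrite mule_ge0// lee_fin normal_pdf_ge0.
apply: eq_integral => x _ /=; congr (_ * (_)%:E)%E.
by rewrite !normal_pdfE ?oner_eq0// /normal_fun !subr0 sqrrN.
Qed.

(** * Gaussian vectors and orthogonal invariance *)

Section plane.
Context {R : realType}.
Local Notation T := (measurableTypeR R).
Local Notation mu := (@lebesgue_measure R).
Local Open Scope ereal_scope.

Lemma ge0_integral_shear2 (a : R) (f : T * T -> \bar R) :
  measurable_fun setT f -> (forall z, 0 <= f z) ->
  \int[mu]_x \int[mu]_y f (x, y + a * x)%R = \int[mu]_x \int[mu]_y f (x, y).
Proof.
move=> mf f0; apply: eq_integral => x _.
rewrite (ge0_integral_shift (a * x) (f := fun y => f (x, y)))//.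
by apply: (measurableT_comp mf); exact: measurable_pair1.
Qed.

Lemma ge0_integral_shear1 (a : R) (f : T * T -> \bar R) :
  measurable_fun setT f -> (forall z, 0 <= f z) ->
  \int[mu]_x \int[mu]_y f (x + a * y, y)%R = \int[mu]_x \int[mu]_y f (x, y).
Proof.
move=> mf f0.
have ms : measurable_fun setT (fun z : T * T => f (z.1 + a * z.2, z.2)%R).
  apply: (measurableT_comp mf); apply: measurable_fun_pair => //.
  by apply: measurable_funD => //; apply: measurable_funM.
rewrite [LHS](fubini_tonelli (m1 := mu) (m2 := mu) _ ms (fun=> f0 _)).
rewrite [RHS](fubini_tonelli (m1 := mu) (m2 := mu) _ mf f0).
apply: eq_integral => y _; rewrite /fubini_G/=.
rewrite (ge0_integral_shift (a * y) (f := fun x => f (x, y)))//.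
by apply: (measurableT_comp mf); exact: measurable_pair2.
Qed.

Lemma ge0_integral_rotation (c s : R) (f : T * T -> \bar R) :
  (c ^+ 2 + s ^+ 2 = 1)%R -> s != 0%R ->
  measurable_fun setT f -> (forall z, 0 <= f z) ->
  \int[mu]_x \int[mu]_y f (c * x - s * y, s * x + c * y)%R =
  \int[mu]_x \int[mu]_y f (x, y).
Proof.
(* a rotation is a product of three shears, each preserving Lebesgue measure *)
move=> cs s0 mf f0; set a := ((c - 1) / s)%R.
(* For c = cos theta and s = sin theta, [a] is - tan (theta / 2): the slope of the two outer,
   horizontal shears. The middle, vertical one has slope [s]. *)
have as_ : (a * s = c - 1)%R by rewrite divfK.
have m1 : measurable_fun setT (fun z : T * T => f (z.1 + a * z.2, z.2)%R).
  apply: (measurableT_comp mf); apply: measurable_fun_pair => //.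
  by apply: measurable_funD => //; apply: measurable_funM.
have m2 : measurable_fun setT
    (fun z : T * T => f (z.1 + a * (z.2 + s * z.1), z.2 + s * z.1)%R).
  apply: (measurableT_comp mf); apply: measurable_fun_pair => //.
    apply: measurable_funD => //; apply: measurable_funM => //.
    by apply: measurable_funD => //; apply: measurable_funM.
  by apply: measurable_funD => //; apply: measurable_funM.
rewrite -(ge0_integral_shear1 a mf f0).
rewrite -[RHS](ge0_integral_shear2 s m1 (fun=> f0 _)).
rewrite -[RHS](ge0_integral_shear1 a m2 (fun=> f0 _)).
apply: eq_integral => x _; apply: eq_integral => y _; congr (f (_, _)) => /=.
  apply/eqP; rewrite -subr_eq0; apply/eqP.
  transitivity ((c - 1 - a * s) * x + (- s - 2 * a - a * (a * s)) * y)%R.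
    by ring.
  rewrite as_ subrr mul0r add0r.
  suff -> : (- s - 2 * a - a * (c - 1) = 0)%R by rewrite mul0r.
  apply: (mulfI s0); rewrite mulr0.
  transitivity (- s ^+ 2 - (c + 1) * (a * s))%R; first by ring.
  rewrite as_; transitivity (1 - (c ^+ 2 + s ^+ 2))%R; first by ring.
  by rewrite cs subrr.
transitivity (s * x + (1 + a * s) * y)%R; first by rewrite as_; ring.
by ring.
Qed.

(** The product of the two densities depends on (x, y) only through x^2 + y^2. *)
Lemma normal_pdf_rotation (c s x y : R) : (c ^+ 2 + s ^+ 2 = 1)%R ->
  (normal_pdf 0 1 (c * x - s * y) * normal_pdf 0 1 (s * x + c * y) =
   normal_pdf 0 1 x * normal_pdf 0 1 y)%R.
Proof.
move=> cs; rewrite !normal_pdfE ?oner_eq0// /normal_fun !subr0.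
rewrite [LHS]mulrACA [RHS]mulrACA -!expRD; congr (_ * expR _)%R.
rewrite -!mulrDl; congr (_ / _)%R.
transitivity (- (c ^+ 2 + s ^+ 2) * (x ^+ 2 + y ^+ 2))%R; first by ring.
by rewrite cs; ring.
Qed.

Local Notation N := (@normal_prob R 0 1).

Lemma ge0_integral_normal2 (f : T * T -> \bar R) :
  measurable_fun setT f -> (forall z, 0 <= f z) ->
  \int[N]_x \int[N]_y f (x, y) =
  \int[mu]_x \int[mu]_y
    (f (x, y) * (normal_pdf 0 1 x * normal_pdf 0 1 y)%:E).
Proof.
move=> mf f0.
have mp : measurable_fun [set: T] (fun x => (normal_pdf 0 1 x)%:E).
  by apply/measurable_EFinP; exact: measurable_normal_pdf.
have mF : measurable_fun [set: T] (fun x => \int[N]_y f (x, y)).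
  exact: (measurable_fun_fubini_tonelli_F (m2 := N)).
rewrite ge0_integral_normal_prob//; last by move=> x; exact: integral_ge0.
apply: eq_integral => x _.
have mfx : measurable_fun [set: T] (fun y => f (x, y)).
  by apply: (measurableT_comp mf); exact: measurable_pair1.
rewrite ge0_integral_normal_prob// -ge0_integralZr//.
- by apply: eq_integral => y _; rewrite mulrC EFinM muleA.
- exact: emeasurable_funM.
- by move=> y _; rewrite mule_ge0// lee_fin normal_pdf_ge0.
- by rewrite lee_fin normal_pdf_ge0.
Qed.

Let ge0_integral_normal2_rotation_neq0 (c s : R) (f : T * T -> \bar R) :
  (c ^+ 2 + s ^+ 2 = 1)%R -> s != 0%R ->
  measurable_fun setT f -> (forall z, 0 <= f z) ->
  \int[N]_x \int[N]_y f (c * x - s * y, s * x + c * y)%R =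
  \int[N]_x \int[N]_y f (x, y).
Proof.
move=> cs s0 mf f0.
have mr : measurable_fun setT
    (fun z : T * T => f (c * z.1 - s * z.2, s * z.1 + c * z.2)%R).
  apply: (measurableT_comp mf); apply: measurable_fun_pair => //.
    by apply: measurable_funB; apply: measurable_funM.
  by apply: measurable_funD; apply: measurable_funM.
rewrite (ge0_integral_normal2 mr (fun=> f0 _)) (ge0_integral_normal2 mf f0).
have mg : measurable_fun setT (fun z : T * T =>
    f z * (normal_pdf 0 1 z.1 * normal_pdf 0 1 z.2)%:E).
  apply: emeasurable_funM => //; apply/measurable_EFinP; apply: measurable_funM.
    by apply: (measurableT_comp (measurable_normal_pdf _ _)).
  by apply: (measurableT_comp (measurable_normal_pdf _ _)).
rewrite -[RHS](ge0_integral_rotation cs s0 mg); last first.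
  by move=> z; rewrite mule_ge0// lee_fin mulr_ge0// normal_pdf_ge0.
by apply: eq_integral => x _; apply: eq_integral => y _ /=;
  rewrite normal_pdf_rotation.
Qed.

Lemma ge0_integral_normal2_rotation (c s : R) (f : T * T -> \bar R) :
  (c ^+ 2 + s ^+ 2 = 1)%R -> measurable_fun setT f -> (forall z, 0 <= f z) ->
  \int[N]_x \int[N]_y f (c * x - s * y, s * x + c * y)%R =
  \int[N]_x \int[N]_y f (x, y).
Proof.
move=> cs mf f0; have [s0|s0] := eqVneq s 0%R; last first.
  exact: ge0_integral_normal2_rotation_neq0.
move: cs; rewrite s0 expr0n/= addr0 => /eqP; rewrite sqrf_eq1 => /orP[]/eqP->.
  apply: eq_integral => x _; apply: eq_integral => y _.
  by congr (f (_, _)); ring.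
(* the half turn is the square of a quarter turn *)
have q : ((0 : R) ^+ 2 + 1 ^+ 2 = 1)%R by rewrite expr0n expr1n add0r.
have mr : measurable_fun setT (fun z : T * T => f (- z.2, z.1)%R).
  by apply: (measurableT_comp mf); apply: measurable_fun_pair => //;
    exact: measurableT_comp.
rewrite -[RHS](ge0_integral_normal2_rotation_neq0 q (oner_neq0 _) mf f0).
rewrite [RHS](_ : _ = \int[N]_x \int[N]_y f (- y, x)%R); last first.
  by apply: eq_integral => x _; apply: eq_integral => y _; congr (f (_, _)); ring.
rewrite -[RHS](ge0_integral_normal2_rotation_neq0 q (oner_neq0 _) mr (fun=> f0 _)).
by apply: eq_integral => x _; apply: eq_integral => y _; congr (f (_, _)) => /=; ring.
Qed.

End plane.

Section gaussian_vector.
Context {R : realType}.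
Local Notation T := (measurableTypeR R).
Local Notation N := (@normal_prob R 0 1).
Local Open Scope ereal_scope.

(** [std_normal] lives on tuples, on which matrices do not act; the image under the identity matrix
    carries it over to column vectors. *)
Definition gvec n : probability (bvec R n) R :=
  distribution (std_normal n) (linear_image 1%:M).

Definition ccons n (z : T * bvec R n) : bvec R n.+1 :=
  col_mx (z.1%:M : 'M[R]_1) (z.2 : 'cV[R]_n).

Lemma measurable_ccons n : measurable_fun setT (@ccons n).
Proof.
apply: measurable_bvec => i; rewrite /ccons.
have -> : i = @unsplit 1 n (fintype.split (i : 'I_(1 + n))) by rewrite splitK.
case: fintype.split => j /=.
- rewrite (_ : (fun _ => _) = fst)//.
  by apply/funext => z; rewrite [LHS](@col_mxEu _ 1 n 1) (ord1 j) mxE eqxx mulr1n.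
- rewrite (_ : (fun _ => _) =
    (fun v : bvec R n => (v : 'cV_n) j ord0 : T) \o snd).
    by apply: measurableT_comp => //; exact: measurable_bvec_coord.
  by apply/funext => z; rewrite [LHS](@col_mxEd _ 1 n 1).
Qed.

Lemma measurable_mulmx m n (A : 'M[R]_(m, n)) :
  measurable_fun setT (fun v : bvec R n => A *m (v : 'cV_n) : bvec R m).
Proof.
apply: measurable_bvec => i.
rewrite (_ : (fun _ => _) =
    fun v : bvec R n => \sum_j A i j * (v : 'cV_n) j ord0 : T)%R; last first.
  by apply/funext => v; rewrite mxE.
apply: measurable_sum => j; apply: measurable_funM => //.
exact: measurable_bvec_coord.
Qed.

Lemma ge0_integral_linear_image n (A : 'M[R]_n) (f : bvec R n -> \bar R) :
  measurable_fun setT f -> (forall v, 0 <= f v) ->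
  \int[distribution (std_normal n) (linear_image A)]_v f v =
  \int[std_normal n]_z f (linear_image A z).
Proof.
by move=> mf f0; rewrite ge0_integral_distribution.
Qed.

Lemma ge0_integral_gvec n (A : 'M[R]_n) (f : bvec R n -> \bar R) :
  measurable_fun setT f -> (forall v, 0 <= f v) ->
  \int[distribution (std_normal n) (linear_image A)]_v f v =
  \int[gvec n]_v f (A *m (v : 'cV_n)).
Proof.
move=> mf f0; rewrite !ge0_integral_linear_image//.
  by apply: eq_integral => z _; rewrite /linear_image mul1mx.
by apply: (measurableT_comp mf); exact: measurable_mulmx.
Qed.

(** The first coordinate is independent of the others. This is how the induction on the dimension
    reaches into the law. *)
Lemma ge0_integral_gvecS n (f : bvec R n.+1 -> \bar R) :
  measurable_fun setT f -> (forall v, 0 <= f v) ->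
  \int[gvec n.+1]_v f v = \int[N]_x \int[gvec n]_v f (ccons (x, v)).
Proof.
move=> mf f0.
have mi : measurable_fun setT (f \o (linear_image (1%:M : 'M[R]_n.+1))).
  by apply: measurableT_comp => //; exact: measurable_linear_image.
rewrite ge0_integral_linear_image//= ge0_integral_distribution//.
rewrite fubini_tonelli1//; last 2 first.
- by apply: (measurableT_comp mi); exact: measurable_tcons.
- by move=> z; exact: f0.
apply: eq_integral => x _; rewrite /fubini_F/=.
rewrite ge0_integral_linear_image//.
  apply: eq_integral => z _; rewrite /ccons /linear_image !mul1mx/=.
  congr (f _); apply/colP => i.
  have -> : i = @unsplit 1 n (fintype.split (i : 'I_(1 + n))) by rewrite splitK.
  case: fintype.split => j /=.
    by rewrite [RHS]col_mxEu (ord1 j) !mxE eqxx mulr1n.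
  rewrite [RHS]col_mxEd !mxE (_ : rshift 1 j = lift ord0 j) ?tnthS//.
  exact: val_inj.
apply: (measurableT_comp mf); apply: (measurableT_comp (@measurable_ccons n)).
exact: measurable_pair1.
Qed.

End gaussian_vector.

(** * Orthogonal matrices: Givens rotations and Householder reflections *)

Section orthogonal_matrices.
Context {R : realType}.

Lemma orthogonal_unitmx n (Q : 'M[R]_n) : Q^T *m Q = 1%:M -> Q \in unitmx.
Proof. by move/mulmx1_unit => []. Qed.

Lemma orthogonalM n (P Q : 'M[R]_n) :
  P^T *m P = 1%:M -> Q^T *m Q = 1%:M -> (P *m Q)^T *m (P *m Q) = 1%:M.
Proof.
by move=> PP QQ; rewrite trmx_mul -mulmxA [P^T *m _]mulmxA PP mul1mx.
Qed.

(** Givens rotation in the plane of the first two coordinates. *)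
Definition rotation_mx n (c s : R) : 'M[R]_(1 + (1 + n)) :=
  block_mx c%:M (row_mx (- s)%:M 0) (col_mx s%:M 0) (block_mx c%:M 0 0 1%:M).

Lemma rotation_mxE n k (c s : R) (x y : 'rV[R]_k) (v : 'M[R]_(n, k)) :
  rotation_mx n c s *m col_mx x (col_mx y v) =
  col_mx (c *: x - s *: y) (col_mx (s *: x + c *: y) v).
Proof.
rewrite /rotation_mx mul_block_col mul_row_col mul_col_mx mul_block_col.
rewrite !mul0mx mul1mx addr0 add0r add_col_mx add0r addr0 !mul_scalar_mx.
by rewrite scaleNr.
Qed.

Lemma rotation_mx_orthogonal n (c s : R) : c ^+ 2 + s ^+ 2 = 1 ->
  (rotation_mx n c s)^T *m rotation_mx n c s = 1%:M.
Proof.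
move=> cs.
have -> : (rotation_mx n c s)^T = rotation_mx n c (- s).
  rewrite /rotation_mx !tr_block_mx tr_col_mx tr_row_mx !tr_scalar_mx.
  by rewrite !trmx0 opprK.
(* The product is applied to the identity, cut into its first row, its second row and the rest, so
   that [rotation_mxE] computes it. *)
rewrite -[LHS]mulmx1 -mulmxA; set I := (1%:M : 'M[R]_(1 + (1 + n))).
rewrite -(vsubmxK I) -(vsubmxK (dsubmx I)) !rotation_mxE.
move: (usubmx I) (usubmx (dsubmx I)) => X Y; congr (col_mx _ (col_mx _ _)).
  apply/matrixP => i j; rewrite !mxE; transitivity ((c ^+ 2 + s ^+ 2) * X i j).
    by ring.
  by rewrite cs mul1r.
apply/matrixP => i j; rewrite !mxE; transitivity ((c ^+ 2 + s ^+ 2) * Y i j).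
  by ring.
by rewrite cs mul1r.
Qed.

Lemma enormE n (x : 'cV[R]_n) : (enorm x ^+ 2)%:M = x^T *m x.
Proof.
apply/matrixP => i j; rewrite !ord1 !mxE eqxx mulr1n.
rewrite /enorm sqr_sqrtr; last by apply: sumr_ge0 => k _; exact: sqr_ge0.
by apply: eq_bigr => k _; rewrite mxE expr2.
Qed.

Lemma orthogonal_block n (Q : 'M[R]_n) : Q^T *m Q = 1%:M ->
  (block_mx (1%:M : 'M[R]_1) 0 0 Q)^T *m block_mx 1%:M 0 0 Q = 1%:M.
Proof.
move=> QQ; rewrite tr_block_mx !trmx0 trmx1 mulmx_block !mul0mx !mulmx0 mulmx1.
by rewrite !addr0 add0r QQ -scalar_mx_block.
Qed.

(** Reflection in the hyperplane orthogonal to u = w - e, where e = |w| e_1 has the same norm as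
    [w]. If w = e, then u determines no hyperplane and the identity serves. *)
Lemma householder n (w : 'cV[R]_(1 + n)) : exists H : 'M[R]_(1 + n),
  H^T *m H = 1%:M /\ H *m w = col_mx (enorm w)%:M (0 : 'cV_n).
Proof.
set r := enorm w; pose e := col_mx r%:M (0 : 'cV[R]_n).
rewrite -/e.
have [we|we] := eqVneq (w - e) 0.
  by exists 1%:M; rewrite trmx1 !mul1mx; split=> //; apply/eqP; rewrite -subr_eq0 we.
set u := w - e; pose a := 2 / enorm u ^+ 2.
have u0 : enorm u ^+ 2 != 0 by rewrite sqrf_eq0 enorm_eq0.
have uu : u^T *m u = (enorm u ^+ 2)%:M by rewrite enormE.
have ee : e^T *m e = (r ^+ 2)%:M.
  by rewrite /e tr_col_mx mul_row_col trmx0 mul0mx addr0 tr_scalar_mx -scalar_mxM.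
have we_sym : w^T *m e = e^T *m w.
  by apply/matrixP => i j; rewrite !ord1 !mxE; apply: eq_bigr => k _;
    rewrite !mxE mulrC.
(* |w| = |e| gives |u|^2 = 2 <u, w>, so the reflection subtracts exactly u from [w] and leaves e. *)
have uw : a *: (u^T *m w) = 1%:M.
  have -> : u^T *m w = (enorm u ^+ 2 / 2)%:M.
    have : u^T *m u = u^T *m w *+ 2.
      rewrite {2}/u mulmxBr /u linearB/= !mulmxBl -enormE ee we_sym -/r.
      by rewrite -[X in _ - X]opprB opprK mulr2n.
    rewrite uu => /matrixP uE; apply/matrixP => i j; move: (uE i j).
    rewrite !ord1 mulmxnE; set z := (u^T *m w) _ _.
    by rewrite !mxE eqxx !mulr1n => ->; rewrite -(mulr_natr z 2) mulfK.
  by rewrite scale_scalar_mx /a mulrA divfK// divff.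
pose P := u *m u^T.
have PP : P *m P = enorm u ^+ 2 *: P.
  by rewrite /P mulmxA -(mulmxA u) uu mul_mx_scalar scalemxAl.
have PT : P^T = P by rewrite /P trmx_mul trmxK.
exists (1%:M - a *: P); split; last first.
  rewrite mulmxBl mul1mx -scalemxAl /P -mulmxA scalemxAr uw mulmx1.
  by rewrite /u opprB addrC subrK.
have -> : (1%:M - a *: P)^T = 1%:M - a *: P.
  by rewrite linearB/= trmx1 linearZ/= PT.
rewrite mulmxBl mul1mx mulmxBr mulmx1.
rewrite -scalemxAl -scalemxAr PP !scalerA (_ : a * a * enorm u ^+ 2 = a + a).
  rewrite [X in _ - X](_ : _ = - (a *: P)) ?opprK ?subrK//.
  by rewrite scalerDl opprD addrA subrr sub0r.
by rewrite -mulrA {2}/a divfK// mulr_natr mulr2n.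
Qed.

(** One step of a QR factorisation. An orthogonal [H] on the last coordinates brings the first
    column of [Q] to (c, r, 0, ..., 0) with c^2 + r^2 = 1, and a plane rotation brings that to e_1;
    orthogonality then clears the first row. Only the rotation mixes the first coordinate with
    others, so invariance of the Gaussian law comes down to the plane and to induction. *)
Lemma orthogonal_decomposition n (Q : 'M[R]_(1 + (1 + n))) : Q^T *m Q = 1%:M ->
  exists (c s : R) (H Y : 'M[R]_(1 + n)),
    [/\ c ^+ 2 + s ^+ 2 = 1, H^T *m H = 1%:M, Y^T *m Y = 1%:M &
      rotation_mx n c s *m block_mx 1%:M 0 0 H *m Q = block_mx 1%:M 0 0 Y].
Proof.
move=> QQ; pose q := lsubmx Q.
have qq : q^T *m q = 1%:M.
  move: QQ; rewrite -(hsubmxK Q) tr_row_mx mul_col_row scalar_mx_block.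
  by case/eq_block_mx.
have [H [HH Hw]] := householder (dsubmx q).
pose c := usubmx q ord0 ord0; pose r := enorm (dsubmx q).
have qE : q = col_mx c%:M (dsubmx q).
  by rewrite -[LHS]vsubmxK [usubmx q]mx11_scalar.
have cr : c ^+ 2 + r ^+ 2 = 1.
  move: qq; rewrite {1 2}qE tr_col_mx mul_row_col tr_scalar_mx -scalar_mxM.
  rewrite -enormE -raddfD/= => /matrixP/(_ ord0 ord0).
  by rewrite !mxE eqxx !mulr1n -expr2.
have cr' : c ^+ 2 + (- r) ^+ 2 = 1 by rewrite sqrrN.
set A := rotation_mx n c (- r) *m block_mx 1%:M 0 0 H *m Q.
have AA : A^T *m A = 1%:M.
  apply: orthogonalM => //; apply: orthogonalM; last exact: orthogonal_block.
  exact: rotation_mx_orthogonal.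
have Aq : lsubmx A = col_mx 1%:M 0.
  rewrite /A -{1}(hsubmxK Q) mul_mx_row row_mxKl -/q -mulmxA qE mul_block_col.
  rewrite !mul0mx mul1mx addr0 add0r.
  rewrite Hw rotation_mxE -/r !scale_scalar_mx.
  rewrite -[in X in col_mx X]raddfB -raddfD/= mulNr opprK -!expr2 cr.
  by rewrite mulNr mulrC addNr raddf0 col_mx0.
exists c, (- r), H, (dsubmx (rsubmx A)).
have AE : A = block_mx 1%:M (usubmx (rsubmx A)) 0 (dsubmx (rsubmx A)).
  by rewrite block_mxEh vsubmxK -Aq hsubmxK.
move: AA; rewrite {1 2}AE tr_block_mx mulmx_block trmx1 trmx0 !mul1mx !mul0mx.
rewrite addr0 !mulmx0 addr0 !mulmx1 scalar_mx_block => /eq_block_mx[_ A0 _ A1].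
move: A1; rewrite A0 mulmx0 add0r => A1.
by split => //; rewrite -/A {1}AE A0.
Qed.

End orthogonal_matrices.

Section orthogonal_invariance.
Context {R : realType}.
Local Notation T := (measurableTypeR R).
Local Notation N := (@normal_prob R 0 1).
Local Open Scope ereal_scope.

Let invariant n (Q : 'M[R]_n) := forall f : bvec R n -> \bar R,
  measurable_fun setT f -> (forall v, 0 <= f v) ->
  \int[gvec n]_v f (Q *m (v : 'cV_n)) = \int[gvec n]_v f v.

Let invariantM n (P Q : 'M[R]_n) : invariant P -> invariant Q -> invariant (P *m Q).
Proof.
move=> iP iQ f mf f0.
have mPf : measurable_fun setT (fun v : bvec R n => f (P *m (v : 'cV_n))).
  by apply: (measurableT_comp mf); exact: measurable_mulmx.
rewrite -(iP f mf f0) -[RHS](iQ _ mPf)//.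
by apply: eq_integral => v _; rewrite mulmxA.
Qed.

Let invariantV n (P : 'M[R]_n) : P \in unitmx -> invariant P -> invariant (invmx P).
Proof.
move=> uP iP f mf f0.
have mPf : measurable_fun setT (fun v : bvec R n => f (invmx P *m (v : 'cV_n))).
  by apply: (measurableT_comp mf); exact: measurable_mulmx.
rewrite -[LHS](iP _ mPf)//.
by apply: eq_integral => v _; rewrite mulmxA mulVmx// mul1mx.
Qed.

Let invariant_block n (Q : 'M[R]_n) : invariant Q ->
  invariant (block_mx 1%:M 0 0 Q : 'M[R]_(1 + n)).
Proof.
move=> iQ f mf f0.
have mA : measurable_fun setT (fun v : bvec R n.+1 =>
    f ((block_mx 1%:M 0 0 Q : 'M[R]_(1 + n)) *m (v : 'cV_n.+1))).
  by apply: (measurableT_comp mf); exact: measurable_mulmx.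
rewrite (ge0_integral_gvecS mA (fun=> f0 _)) (ge0_integral_gvecS mf f0).
apply: eq_integral => x _.
have mfx : measurable_fun setT (fun v : bvec R n => f (ccons (x, v))).
  apply: (measurableT_comp mf); apply: (measurableT_comp (@measurable_ccons R n)).
  exact: measurable_pair1.
rewrite -(iQ _ mfx (fun=> f0 _)); apply: eq_integral => v _.
by rewrite /ccons/= mul_block_col mul1mx !mul0mx addr0 add0r.
Qed.

Let invariant_rotation n (c s : R) : (c ^+ 2 + s ^+ 2 = 1)%R ->
  invariant (rotation_mx n c s).
Proof.
move=> cs f mf f0.
have mr : measurable_fun setT (fun v : bvec R n.+2 =>
    f (rotation_mx n c s *m (v : 'cV_n.+2))).
  by apply: (measurableT_comp mf); exact: measurable_mulmx.
have mc : measurable_fun setT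
   (fun z : (T * T) * bvec R n => f (ccons (z.1.1, ccons (z.1.2, z.2)))).
  apply: (measurableT_comp mf); apply: (measurableT_comp (@measurable_ccons R n.+1)).
  apply: measurable_fun_pair => /=; first exact: measurableT_comp.
  apply: (measurableT_comp (@measurable_ccons R n)).
  by apply: measurable_fun_pair => //=; exact: measurableT_comp.
have E (g : bvec R n.+2 -> \bar R) : measurable_fun setT g -> (forall v, 0 <= g v) ->
    \int[gvec n.+2]_v g v =
    \int[N]_x \int[N]_y \int[gvec n]_v g (ccons (x, ccons (y, v))).
  move=> mg g0; rewrite ge0_integral_gvecS//; apply: eq_integral => x _.
  rewrite ge0_integral_gvecS//.
  apply: (measurableT_comp mg); apply: (measurableT_comp (@measurable_ccons R n.+1)).
  exact: measurable_pair1.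
rewrite (E _ mr (fun=> f0 _)) (E _ mf f0).
pose F (z : T * T) := \int[gvec n]_v f (ccons (z.1, ccons (z.2, v))).
have mF : measurable_fun setT F.
  exact: (measurable_fun_fubini_tonelli_F (m2 := gvec n) _ mc (fun=> f0 _)).
have F0 z : 0 <= F z by exact: integral_ge0.
rewrite -[RHS](ge0_integral_normal2_rotation cs mF F0).
apply: eq_integral => x _; apply: eq_integral => y _; apply: eq_integral => v _.
by rewrite /ccons/= rotation_mxE !scale_scalar_mx -!raddfD/= -raddfN -raddfD.
Qed.

(** Dimensions 0 and 1 are treated directly, the latter with Q = 1 or Q = -1. From dimension two on,
    [orthogonal_decomposition] writes [Q] in terms of a plane rotation and of blocks [H], [Y] in one
    dimension less. *)
Lemma gvec_orthogonal n (Q : 'M[R]_n) : Q^T *m Q = 1%:M ->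
  forall f : bvec R n -> \bar R,
    measurable_fun setT f -> (forall v, 0 <= f v) ->
  \int[gvec n]_v f (Q *m (v : 'cV_n)) = \int[gvec n]_v f v.
Proof.
elim: n Q => [Q _ f mf f0|[|n] IH Q QQ].
- by apply: eq_integral => v _; rewrite flatmx0 [in RHS]flatmx0.
- move=> f mf f0.
  have /eqP : (Q ord0 ord0 ^+ 2 = 1)%R.
    by have /matrixP/(_ ord0 ord0) := QQ; rewrite !mxE big_ord1 !mxE expr2.
  have QE : Q = (Q ord0 ord0)%:M.
    by apply/matrixP => i j; rewrite !ord1 !mxE eqxx mulr1n.
  rewrite sqrf_eq1 => /orP[] /eqP q1.
    by apply: eq_integral => v _; rewrite QE q1 mul1mx.
  have mQ : measurable_fun setT (fun v : bvec R 1 => f (Q *m (v : 'cV_1))).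
    by apply: (measurableT_comp mf); exact: measurable_mulmx.
  rewrite (ge0_integral_gvecS mQ (fun=> f0 _)) (ge0_integral_gvecS mf f0).
  pose F (x : T) := \int[gvec 0]_v f (ccons (x, v)).
  have mF : measurable_fun setT F.
    apply: (measurable_fun_fubini_tonelli_F (m2 := gvec 0) (fun z => f (ccons z))) => //.
    by apply: (measurableT_comp mf); exact: measurable_ccons.
  rewrite -[RHS](ge0_integral_normal_probN mF) => [|x]; last exact: integral_ge0.
  apply: eq_integral => x _; apply: eq_integral => v _; congr (f _).
  rewrite QE q1 /ccons/= mul_scalar_mx [LHS](@scale_col_mx _ 1 0 1) scale_scalar_mx mulN1r.
  suff -> : -1 *: (v : 'cV[R]_0) = v by [].
  by rewrite [LHS]flatmx0 [RHS]flatmx0.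
have [c [s [H [Y [cs HH YY E]]]]] := orthogonal_decomposition QQ.
set P := rotation_mx n c s *m block_mx 1%:M 0 0 H in E.
have uP : P \in unitmx.
  apply/orthogonal_unitmx/orthogonalM; last exact: orthogonal_block.
  exact: rotation_mx_orthogonal.
have -> : Q = invmx P *m block_mx 1%:M 0 0 Y by rewrite -E mulmxA mulVmx// mul1mx.
apply: invariantM; last by apply: invariant_block; exact: IH.
apply: invariantV => //; apply: invariantM; first exact: invariant_rotation.
by apply: invariant_block; exact: IH.
Qed.

End orthogonal_invariance.

(** * Cholesky factorisation of positive definite matrices *)

Section cholesky.
Context {R : realType}.

Lemma qform_block n (a : R) (b : 'cV[R]_n) (C : 'M[R]_n) (x : R) (y : 'cV[R]_n) :
  qform (block_mx a%:M b^T b C) (col_mx x%:M y) =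
  a * x ^+ 2 + 2 * x * (b^T *m y) ord0 ord0 + qform C y.
Proof.
rewrite /qform tr_col_mx tr_scalar_mx mul_row_block mul_row_col mulmxDl.
rewrite mulmxDl !mul_mx_scalar mul_scalar_mx -scalemxAl.
have -> : y^T *m b = b^T *m y.
  by apply/matrixP => i j; rewrite !ord1 !mxE; apply: eq_bigr => k _;
    rewrite !mxE mulrC.
by rewrite mxE [X in X + _]mxE [X in _ + X]mxE !mxE eqxx mulr1n; ring.
Qed.

(** The leading entry [a] is positive and the Schur complement C - b b^T / a is again positive
    definite, so induction gives the lower right block [L] of the factor. *)
Lemma posdef_factor n (S : 'M[R]_n) : S^T = S ->
  (forall x, x != 0 -> 0 < qform S x) -> exists A : 'M[R]_n, A *m A^T = S.
Proof.
elim: n S => [S _ _|n IH S SS pS]; first by exists 0; rewrite flatmx0 [RHS]flatmx0.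
move: S SS pS; change (n.+1) with (1 + n)%N => S SS pS.
pose a := ulsubmx S ord0 ord0; pose b := dlsubmx S; pose C := drsubmx S.
have SE : S = block_mx a%:M b^T b C.
  by rewrite /b trmx_dlsub SS -(mx11_scalar (ulsubmx S)) submxK.
have CC : C^T = C by rewrite /C trmx_drsub SS.
have a0 : 0 < a.
  have := pS (col_mx 1%:M 0); rewrite SE qform_block expr1n mulr1.
  rewrite mulmx0 mxE mulr0 addr0 /qform mulmx0 mxE addr0; apply.
  by apply/eqP => /eqP; rewrite col_mx_eq0 => /andP[/eqP/matrixP/(_ ord0 ord0)/eqP];
    rewrite !mxE eqxx oner_eq0.
pose C' := C - a^-1 *: (b *m b^T).
have C'C' : C'^T = C'.
  by rewrite /C' linearB/= linearZ/= trmx_mul trmxK CC.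
have [|L LL] := IH C' C'C'.
  move=> y y0; set be := (b^T *m y) ord0 ord0.
  (* For fixed [y], the first coordinate - be / a minimises the form of [S], and the minimum is the
     form of the Schur complement at [y]. *)
  have := pS (col_mx (- be / a)%:M y); rewrite SE qform_block -/be.
  rewrite (_ : a * _ + _ + _ = qform C' y); last first.
    rewrite /qform mulmxBr mulmxBl -scalemxAr -scalemxAl mulmxA.
    have -> : y^T *m b *m b^T *m y = (be ^+ 2)%:M.
      rewrite -mulmxA (_ : y^T *m b = (b^T *m y)^T); last by rewrite trmx_mul trmxK.
      rewrite (mx11_scalar (b^T *m y)) -/be tr_scalar_mx -scalar_mxM.
      by rewrite expr2.
    rewrite scale_scalar_mx; set W := _ *m y.
    rewrite [RHS]mxE [X in _ = _ + X]mxE [X in _ = _ - X]mxE eqxx mulr1n.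
    by field; rewrite gt_eqF.
  apply; apply: contraNneq y0 => /eqP; rewrite col_mx_eq0 => /andP[_ /eqP ->] //.
exists (block_mx (Num.sqrt a)%:M 0 ((Num.sqrt a)^-1 *: b) L).
have s0 : Num.sqrt a != 0 by rewrite gt_eqF// sqrtr_gt0.
have ss : Num.sqrt a * Num.sqrt a = a by rewrite -expr2 sqr_sqrtr// ltW.
rewrite tr_block_mx mulmx_block trmx0 tr_scalar_mx !mul0mx !mulmx0 !addr0.
rewrite linearZ/= !mul_scalar_mx mul_mx_scalar !scalerA mulfV// !scale1r LL.
rewrite scale_scalar_mx ss -scalemxAl -scalemxAr scalerA -invfM ss /C'.
by rewrite addrC subrK SE.
Qed.

End cholesky.

(** * Image of the angular central Gaussian law under a linear map *)

Section ACG_image.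
Context {R : realType}.
Local Open Scope ereal_scope.
Local Notation T := (measurableTypeR R).

Lemma measurable_bvec0 n : measurable ([set (0 : 'cV[R]_n)%R] : set (bvec R n)).
Proof.
rewrite (_ : [set _] = (@enorm R n) @^-1` [set 0%R]).
  rewrite -[X in measurable X]setTI; apply: (@measurable_enorm R n) => //.
by apply/seteqP; split => x /=; [move=> ->; rewrite enorm0|
  move=> /eqP; rewrite enorm_eq0 => /eqP].
Qed.

(** [gaussian] picks some B with B B^T = A A^T. Then A^-1 B is orthogonal, so the invariance of
    [gvec] lets [A] replace B. *)
Lemma ge0_integral_gaussian n (A : 'M[R]_n) (f : bvec R n -> \bar R) :
  A \in unitmx -> measurable_fun setT f -> (forall v, 0 <= f v) ->
  \int[gaussian (A *m A^T)]_v f v = \int[gvec n]_v f (A *m (v : 'cV_n)).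
Proof.
move=> uA mf f0; rewrite /gaussian; set B := xget _ _.
have BB : B *m B^T = A *m A^T.
  by rewrite /B; case: xgetP => [B' _ //|/(_ A) []].
rewrite ge0_integral_gvec//.
have QQ : (invmx A *m B)^T *m (invmx A *m B) = 1%:M.
  apply: mulmx1C; rewrite trmx_mul mulmxA -(mulmxA _ B) BB mulmxA mulVmx// mul1mx.
  by rewrite trmx_inv mulmxV// unitmx_tr.
have mA : measurable_fun setT (fun v : bvec R n => f (A *m (v : 'cV_n))).
  by apply: (measurableT_comp mf); exact: measurable_mulmx.
rewrite -[RHS](gvec_orthogonal QQ mA (fun=> f0 _)).
by apply: eq_integral => v _; rewrite mulmxA mulKVmx.
Qed.

(** The origin, where the value of [normalize] is arbitrary, has to be negligible. Its indicator is
    bounded by that of a vanishing first coordinate, and the normal law gives no mass to a point. *)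
Lemma gvec_eq0 n : gvec n.+1 [set (0 : 'cV[R]_n.+1)%R] = 0.
Proof.
have m0 := @measurable_bvec0 n.+1.
have m1 : measurable ([set 0%R] : set T) by exact: measurable_set1.
have N0 : normal_prob 0 1 [set (0 : R)%R] = 0.
  have /null_content_dominatesP := normal_prob_dominates (0 : R) 1.
  by move=> /(_ _ m1); apply; exact: lebesgue_measure_set1.
apply/eqP; rewrite -measure_le0.
have mi : measurable_fun setT
    (fun v : bvec R n.+1 => (\1_[set (0 : 'cV[R]_n.+1)%R] v)%:E : \bar R).
  by apply/measurable_EFinP; exact: measurable_indic.
suff : \int[gvec n.+1]_v (\1_[set (0 : 'cV[R]_n.+1)%R] v)%:E <= 0.
  by rewrite integral_indic// setIT.
rewrite ge0_integral_gvecS//.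
have -> : 0 = \int[normal_prob 0 1]_x (\1_([set 0%R] : set T) x)%:E.
  by rewrite integral_indic// setIT; exact/esym.
apply: ge0_le_integral => //.
- by move=> x _; exact: integral_ge0.
- apply: (measurable_fun_fubini_tonelli_F (m2 := gvec n)
    (fun z => (\1_[set (0 : 'cV[R]_n.+1)%R] (ccons z))%:E)) => //.
  exact: (measurableT_comp mi (@measurable_ccons R n)).
- by apply/measurable_EFinP; exact: measurable_indic.
move=> x _; rewrite -[leRHS]mule1 -(@probability_setT _ _ R (gvec n)).
rewrite -integral_cst//; apply: ge0_le_integral => //.
- apply: (measurableT_comp mi).
  by apply: (measurableT_comp (@measurable_ccons R n)); exact: measurable_pair1.
- move=> v _; rewrite lee_fin !indicE; case: (boolP (_ \in [set 0%R])) => //.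
  rewrite inE/= /ccons/= => /eqP; rewrite [_ == 0%R](@col_mx_eq0 _ 1 n 1).
  case/andP => /eqP/matrixP/(_ ord0 ord0); rewrite !mxE eqxx mulr1n => -> _.
  by rewrite mem_set.
Qed.

Lemma normalizeZ n (c : R) (x : 'cV[R]_n.+1) : (0 < c)%R ->
  normalize (c *: x)%R = normalize x.
Proof.
move=> c0; apply: val_inj; rewrite !val_normalize scaler_eq0 gt_eqF//=.
case: ifPn => // x0; rewrite enormZ gtr0_norm// scalerA invfM mulrC mulrA.
by rewrite mulfV ?mul1r// gt_eqF.
Qed.

Lemma normalize_mul n (G : 'M[R]_n.+1) (y : 'cV[R]_n.+1) : y != 0%R ->
  normalize (G *m val (normalize y)) = normalize (G *m y).
Proof.
move=> y0; rewrite val_normalize (negbTE y0) -scalemxAr normalizeZ//.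
by rewrite invr_gt0 lt0r enorm_eq0 y0 sqrtr_ge0.
Qed.

Lemma measurable_val_sphere n : measurable_fun setT
  (fun x : sphere R n => val x : bvec R n.+1).
Proof.
apply: (@measurability _ _ (sphere R n) (bvec R n.+1) _ _ (@open 'cV[R]_n.+1)) => //.
move=> _ [U oU <-]; rewrite setTI; apply: sub_sigma_algebra.
by exists U.
Qed.

Lemma ge0_integral_ACG n (A : 'M[R]_n.+1) (f : sphere R n -> \bar R) :
  A \in unitmx -> measurable_fun setT f -> (forall x, 0 <= f x) ->
  \int[ACG (A *m A^T)]_x f x =
  \int[gvec n.+1]_v f (normalize (A *m (v : 'cV_n.+1))).
Proof.
move=> uA mf f0; have mn : measurable_fun setT (f \o @normalize R n).
  by apply: measurableT_comp => //; exact: measurable_normalize.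
rewrite (ge0_integral_distribution _ mf f0).
exact: (ge0_integral_gaussian uA mn (fun=> f0 _)).
Qed.

(** If A A^T = S, then G A is a factor of G S G^T, and normalising once more before [G] is applied
    does not change the resulting point of the sphere. This may fail at v = 0, so the integrands are
    compared almost everywhere. *)
Lemma ACG_mul n (S G : 'M[R]_n.+1) (f : sphere R n -> \bar R) :
  S^T = S -> (forall x, x != 0%R -> (0 < qform S x)%R) -> G \in unitmx ->
  measurable_fun setT f -> (forall x, 0 <= f x) ->
  \int[ACG (G *m S *m G^T)]_x f x = \int[ACG S]_x f (normalize (G *m val x)).
Proof.
move=> SS pS uG mf f0; have [A AS] := posdef_factor SS pS.
(* A nonzero row v with v A = 0 would give the form of [S] the value |v A|^2 = 0. *)
have uA : A \in unitmx.
  apply: contraT => nuA; have /rowV0Pn[v] : kermx A != 0%R.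
    by rewrite kermx_eq0 -row_free_unit in nuA *.
  move=> /sub_kermxP vA v0; have := pS v^T; rewrite trmx_eq0 => /(_ v0).
  by rewrite /qform -AS trmxK mulmxA vA !mul0mx mxE ltxx.
have -> : G *m S *m G^T = (G *m A) *m (G *m A)^T.
  by rewrite trmx_mul !mulmxA -AS mulmxA.
have mg : measurable_fun setT (fun x : sphere R n => f (normalize (G *m val x))).
  apply: (measurableT_comp mf); apply: (measurableT_comp (@measurable_normalize R n)).
  apply: (measurableT_comp (@measurable_mulmx _ _ _ G)).
  exact: measurable_val_sphere.
have uGA : G *m A \in unitmx by rewrite unitmx_mul uG.
rewrite -AS [LHS](ge0_integral_ACG uGA mf f0).
rewrite [RHS](ge0_integral_ACG uA mg (fun=> f0 _)).
have mL (h : sphere R n -> \bar R) (B : 'M[R]_n.+1) : measurable_fun setT h -> measurable_fun setT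
    (fun v : bvec R n.+1 => h (normalize (B *m (v : 'cV[R]_n.+1))) : \bar R).
  move=> mh; apply: (measurableT_comp mh).
  apply: (measurableT_comp (@measurable_normalize R n)).
  exact: measurable_mulmx.
apply: ge0_ae_eq_integral.
- exact: measurableT.
- exact: (mL f (G *m A) mf).
- exact: (mL _ A mg).
- by move=> x _; exact: f0.
- by move=> x _; exact: f0.
exists [set (0 : 'cV[R]_n.+1)%R]; split.
- exact: measurable_bvec0.
- exact: gvec_eq0.
move=> v /=; apply: contra_notP => v0 _; rewrite -mulmxA normalize_mul//.
apply/eqP => Av0; apply: v0.
by rewrite -[v](mulKmx uA) Av0 mulmx0.
Qed.

End ACG_image.

(** * Linear differential equations *)

Section real_calculus.
Context {R : realType}.
Implicit Types (f g w : R -> R) (a t : R).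

Lemma continuous_sum (T : topologicalType) I (r : seq I) (F : I -> T -> R) (x : T) :
  (forall i, {for x, continuous (F i)}) ->
  {for x, continuous (fun y => \sum_(i <- r) F i y)}.
Proof.
by move=> Fc; apply: (@cvg_big R^o _ +%R 0 xpredT) => [z|i _]; [exact: add_continuous|exact: Fc].
Qed.

Lemma is_derive_bigsum (V : normedModType R) I (r : seq I) (F : I -> V -> R)
    (d : I -> R) (x v : V) :
  (forall i, is_derive x v (F i) (d i)) ->
  is_derive x v (fun s => \sum_(i <- r) F i s) (\sum_(i <- r) d i).
Proof.
move=> Fd; rewrite (_ : (fun s => _) = \sum_(i <- r) F i); last first.
  by apply/funext => s; rewrite fct_sumE.
by elim/big_ind2 : _ => // [|] *; [exact: is_derive_cst|exact: is_deriveD].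
Qed.

Lemma is_derive_continuous f t (d : R) : is_derive t 1 f d -> {for t, continuous f}.
Proof. by case=> df _; apply/differentiable_continuous; exact/derivable1_diffP. Qed.

Lemma is_derive_mul (V : normedModType R) (F G : V -> R) (x v : V) (df dg : R) :
  is_derive x v F df -> is_derive x v G dg ->
  is_derive x v (fun y => F y * G y) (F x * dg + G x * df).
Proof. exact: is_deriveM. Qed.

Lemma is_derive_mulr (V : normedModType R) (F : V -> R) (x v : V) (df c : R) :
  is_derive x v F df -> is_derive x v (fun y => F y * c) (df * c).
Proof.
move=> dF; rewrite (_ : df * c = F x * 0 + c * df); last by rewrite mulr0 add0r mulrC.
by apply: is_derive_mul => //; exact: is_derive_cst.
Qed.

(** Each summand is a full product with one factor replaced: the shape found in the Leibniz
    expansion of a determinant with one row replaced. *)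
Lemma is_derive_prod n (F : 'I_n -> R -> R) (d : 'I_n -> R) t :
  (forall i, is_derive t 1 (F i) (d i)) ->
  is_derive t 1 (fun s => \prod_(i < n) F i s)
    (\sum_(k < n) \prod_(i < n) (if i == k then d i else F i t)).
Proof.
elim: n F d => [|n IH] F d dF.
  rewrite big_ord0 (_ : (fun s => _) = cst 1); first exact: is_derive_cst.
  by apply/funext => s; rewrite big_ord0.
rewrite (_ : (fun s => _) =
    fun s => F ord0 s * \prod_(i < n) F (lift ord0 i) s); last first.
  by apply/funext => s; rewrite big_ord_recl.
have IH' := IH (fun i => F (lift ord0 i)) (fun i => d (lift ord0 i))
  (fun i => dF (lift ord0 i)).
apply: (is_derive_eq (is_derive_mul (dF ord0) IH')).
rewrite big_ord_recl addrC; congr (_ + _).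
  by rewrite big_ord_recl/= mulrC.
rewrite mulr_sumr; apply: eq_bigr => k _; by rewrite big_ord_recl.
Qed.

(** Both [w - f] and [w + f] are nondecreasing. Derivatives are asked for only to the right of [a],
    since the primitives constructed below vanish up to [a] and may have a kink there. *)
Lemma norm_le_is_derive f f' w w' a : continuous f -> continuous w ->
  (forall t, a < t -> is_derive t 1 f (f' t)) ->
  (forall t, a < t -> is_derive t 1 w (w' t)) ->
  (forall t, a < t -> `|f' t| <= w' t) ->
  `|f a| <= w a -> forall t, a <= t -> `|f t| <= w t.
Proof.
move=> cf cw df dw f'w' fwa t at_.
have key g g' : continuous g -> (forall t, a < t -> is_derive t 1 g (g' t)) ->
    (forall t, a < t -> g' t <= w' t) -> g a <= w a -> g t <= w t.
  move=> cg dg g'w' gwa.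
  have dwg s : a < s -> is_derive s 1 (w - g) (w' s - g' s).
    by move=> as_; apply: is_deriveB; [exact: dw|exact: dg].
  have : (w - g) a <= (w - g) t.
    apply: (@ger0_derive1_ndecry R (w - g) a) => //.
    - by move=> x; rewrite in_itv/= andbT => /dwg[].
    - move=> x; rewrite in_itv/= andbT => ax.
      by have [_ ] := dwg _ ax; rewrite derive1E => ->; rewrite subr_ge0 g'w'.
    - apply: continuous_subspaceT => x; apply: (@cvgB _ R^o); [exact: cw|exact: cg].
  rewrite -subr_ge0 -[(w - g) a]/(w a - g a) -[(w - g) t]/(w t - g t) => H.
  rewrite -subr_ge0 (le_trans _ (_ : w a - g a <= _)) ?subr_ge0//.
  by rewrite -subr_ge0.
rewrite ler_norml; apply/andP; split.
  rewrite lerNl; apply: (key (- f) (fun t => - f' t)).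
  - by move=> x; apply: (@cvgN _ R^o); exact: cf.
  - by move=> s as_; apply: is_deriveN; exact: df.
  - by move=> s as_; rewrite (le_trans _ (f'w' _ as_))// -normrN ler_norm.
  - by rewrite (le_trans _ fwa)// -normrN ler_norm.
apply: (key f f') => //.
- by move=> s as_; rewrite (le_trans _ (f'w' _ as_))// ler_norm.
- by rewrite (le_trans _ fwa)// ler_norm.
Qed.

Lemma is_derive_eq0_cst f a : continuous f ->
  (forall t, a < t -> is_derive t 1 f 0) -> forall t, a <= t -> f t = f a.
Proof.
move=> cf df t at_; apply/eqP; rewrite -subr_eq0 -normr_le0.
apply: (@norm_le_is_derive (fun t => f t - f a) (cst 0) (cst 0) (cst 0) a) => //.
- by move=> x; apply: (@cvgB _ R^o); [exact: cf|exact: cvg_cst].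
- by move=> x; exact: cvg_cst.
- by move=> s as_; apply: is_derive_eq; first (apply: is_deriveB; exact: df); rewrite subr0.
- by move=> s _ /=; rewrite normr0.
- by rewrite subrr normr0.
Qed.

Lemma is_derive_Rintegral f a t : continuous f -> a < t ->
  is_derive t 1 (fun u => \int[lebesgue_measure]_(s in `[a, u]) f s) (f t).
Proof.
move=> cf at_.
have fi : lebesgue_measure.-integrable `[a, t + 1] (EFin \o f).
  apply: continuous_compact_integrable; first exact: segment_compact.
  exact: continuous_subspaceT.
have tt : t < t + 1 by rewrite ltrDl.
have [dF F'] := continuous_FTC1_closed tt fi at_ (cf t).
by apply: DeriveDef; [exact: dF|rewrite -derive1E F'].
Qed.

Lemma exists_primitive f a : continuous f -> exists g, [/\ continuous g,
  forall t, t <= a -> g t = 0 & forall t, a < t -> is_derive t 1 g (f t)].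
Proof.
(* Integrating from a - 1 makes [F] differentiable, hence continuous, at [a] itself. Clamping the
   time at [a] then gives a function continuous on the whole line. *)
move=> cf; pose F t := \int[lebesgue_measure]_(s in `[a - 1, t]) f s.
have dF t : a - 1 < t -> is_derive t 1 F (f t) by exact: is_derive_Rintegral.
exists (fun t => F (Num.max t a) - F a); split.
- move=> t; apply: (@cvgB _ R^o); last exact: cvg_cst.
  apply: (@continuous_comp _ _ _ (fun t => Num.max t a) F).
    apply: (@continuous_max R _ id (cst a)); first exact: cvg_id.
    exact: cvg_cst.
  apply: is_derive_continuous; apply: dF.
  by rewrite lt_max [X in _ || X]gtrBl ltr01 orbT.
- by move=> t ta; rewrite max_r// subrr.
- move=> t at_; apply: (@near_eq_is_derive _ _ _ (fun s => F s - F a)).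
    near=> s; rewrite max_l// ltW//; near: s; exact: lt_nbhsr.
  apply: is_derive_eq; first by apply: is_deriveB; apply: dF; rewrite (lt_trans _ at_)// gtrBl.
  by rewrite subr0.
Unshelve. all: by end_near. Qed.

Lemma geometric_series_sum (u : nat -> R) (B : R) :
  (forall k, `|u k| <= B / 2 ^+ k) ->
  exists l, forall N, `|l - \sum_(k < N) u k| <= B * 2 / 2 ^+ N.
Proof.
move=> uB; pose S N := \sum_(k < N) u k.
(* The bound is the exact sum of the majorants B / 2^k for N <= k < N + M, so the induction on M
   telescopes. *)
have SMN N M : `|S (N + M)%N - S N| <= B * 2 / 2 ^+ N - B * 2 / 2 ^+ (N + M).
  elim: M => [|M IH]; first by rewrite addn0 !subrr normr0.
  rewrite addnS /S big_ord_recr/= -/(S (N + M)%N) addrAC.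
  apply: (le_trans (ler_normD _ _)).
  apply: (le_trans (lerD IH (uB _))).
  rewrite exprS invfM mulrA mulfK// -addrA lerD2l.
  by rewrite (mulrC B 2) -mulrA; lra.
have B0 : 0 <= B by have := uB 0; rewrite expr0 divr1; exact: le_trans.
have cS : cvgn (series u).
  apply: normed_cvg; apply: (@series_le_cvg _ _ (geometric B 2^-1)) => [k|k|k|].
  - exact: normr_ge0.
  - by rewrite /= mulr_ge0// exprn_ge0.
  - by rewrite /= exprVn uB.
  - by apply: is_cvg_geometric_series; rewrite ger0_norm// invf_lt1// ltr1n.
exists (limn (series u)) => N; apply/ler_addgt0Pr => e e0.
have /cvgrPdist_lt/(_ _ e0)[M _ HM] := cS.
have {}HM := HM (N + M)%N (leq_addl _ _).
rewrite -[_ - _](subrKA (S (N + M)%N)) (le_trans (ler_normD _ _))//.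
rewrite addrC lerD//; last first.
  by move: HM; rewrite /series/= big_mkord => /ltW.
by rewrite (le_trans (SMN _ _))// gerBl divr_ge0// ?mulr_ge0// exprn_ge0.
Qed.

End real_calculus.

Section linear_ode.
Context {R : realType} {n : nat}.
Variables (A : R -> 'M[R]_n) (a : R).
Hypothesis cA : forall i j, continuous (fun t => A t i j).

(** Made total so that [picard] can be defined before its continuity is known. *)
Let prim (f : R -> R) : R -> R :=
  if pselect (continuous f) is left cf then sval (cid (exists_primitive a cf)) else cst 0.

Let primP f : continuous f -> [/\ continuous (prim f),
  forall t, t <= a -> prim f t = 0 & forall t, a < t -> is_derive t 1 (prim f) (f t)].
Proof. by rewrite /prim => cf; case: pselect => // cf'; case: cid. Qed.

Let mul_continuous (G : R -> 'M[R]_n) : (forall i j, continuous (fun t => G t i j)) ->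
  forall i j, continuous (fun t => (A t *m G t) i j).
Proof.
move=> cG i j; rewrite (_ : (fun t => _) = fun t => \sum_k A t i k * G t k j).
  by move=> t; apply: continuous_sum => k; apply: continuousM; [exact: cA|exact: cG].
by apply/funext => t; rewrite mxE.
Qed.

(** These are the increments of the Picard iteration, not the iterates: the solution is their sum,
    the Peano-Baker series. *)
Fixpoint picard k : R -> 'M[R]_n :=
  if k is k'.+1 then
    fun t => \matrix_(i, j) prim (fun s => (A s *m picard k' s) i j) t
  else fun=> 1%:M.

Let picard_continuous k i j : continuous (fun t => picard k t i j).
Proof.
elim: k i j => [|k IH] i j /=; first by move=> t; exact: cvg_cst.
rewrite (_ : (fun t => _) = prim (fun s => (A s *m picard k s) i j)).
  by have [] := primP (@mul_continuous _ IH i j).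
by apply/funext => t; rewrite mxE.
Qed.

Let picard_derive k i j t : a < t ->
  is_derive t 1 (fun s => picard k.+1 s i j) ((A t *m picard k t) i j).
Proof.
rewrite (_ : (fun t => _) = prim (fun s => (A s *m picard k s) i j)).
  by have [_ _] := primP (@mul_continuous _ (@picard_continuous k) i j); exact.
by apply/funext => s; rewrite mxE.
Qed.

Let picard_a k i j t : t <= a -> picard k.+1 t i j = 0.
Proof.
rewrite mxE; have [_ + _] := primP (@mul_continuous _ (@picard_continuous k) i j).
exact.
Qed.

(* weighting by exp (2 * int |A|) makes the Picard operator a contraction of
   ratio 1/2 on the whole half-line *)
Let c (t : R) : R := \sum_i \sum_j `|A t i j|.
Let w t := expR (2 * prim c t).

Let c_continuous : continuous c.
Proof.
move=> t; apply: continuous_sum => i; apply: continuous_sum => j.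
by apply: (@continuous_comp _ R^o R^o _ Num.norm); [exact: cA|exact: norm_continuous].
Qed.

Let w_continuous : continuous w.
Proof.
move=> t; apply: continuous_comp; last exact: continuous_expR.
apply: continuousM; first exact: cvg_cst.
by have [+ _ _] := primP c_continuous; exact.
Qed.

Let w_derive t : a < t -> is_derive t 1 w (2 * c t * w t).
Proof.
move=> at_; have [_ _ /(_ _ at_) dC] := primP c_continuous.
have dE : is_derive (2 * prim c t) 1 (@expR R) (w t) by exact: is_derive_expR.
have dg : is_derive t 1 (fun s => 2 * prim c s) (2 * c t).
  under eq_fun do rewrite mulrC.
  by rewrite mulrC; exact: is_derive_mulr.
by rewrite mulrC; exact: (@is_derive1_comp _ expR (fun s => 2 * prim c s) t _ _ dE dg).
Qed.

Let w_ge1 t : 1 <= w t.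
Proof.
have [cC C0 dC] := primP c_continuous.
rewrite -expR0 ler_expR mulr_ge0//.
have [ta|/ltW at_] := leP t a; first by rewrite C0.
apply: (le_trans (normr_ge0 (0 : R))).
apply: (@norm_le_is_derive _ (cst 0) (cst 0) (prim c) c a) => //.
- by move=> x; exact: cvg_cst.
- by move=> s _ /=; rewrite normr0 sumr_ge0// => i _; rewrite sumr_ge0.
- by rewrite normr0 C0.
Qed.

Let mul_le (M : 'M[R]_n) t (b : R) i j : (forall k l, `|M k l| <= b) ->
  `|(A t *m M) i j| <= c t * b.
Proof.
move=> Mb; rewrite mxE (le_trans (ler_norm_sum _ _ _))//.
apply: (@le_trans _ _ ((\sum_k `|A t i k|) * b)).
  by rewrite mulr_suml ler_sum// => k _; rewrite normrM ler_wpM2l.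
rewrite ler_wpM2r//; first exact: le_trans (Mb i j).
by rewrite /c [leRHS](bigD1 i)//= lerDl sumr_ge0// => l _; rewrite sumr_ge0.
Qed.

(** As w' = 2 c w, the derivative of w / 2^(k+1) is c w / 2^k, which by induction dominates the
    entries of [A *m picard k]. Up to [a] the increments of positive index vanish. *)
Let picard_le k t i j : `|picard k t i j| <= w t / 2 ^+ k.
Proof.
elim: k t i j => [|k IH] t i j.
  rewrite /= mxE expr0 divr1 (le_trans _ (w_ge1 t))//.
  by case: eqP => _; rewrite ?normr1// normr0.
have [ta|/ltW at_] := leP t a.
  by rewrite picard_a// normr0 divr_ge0 ?expR_ge0// exprn_ge0.
apply: (@norm_le_is_derive _ (fun s => picard k.+1 s i j)
  (fun s => (A s *m picard k s) i j)
  (fun s => w s / 2 ^+ k.+1) (fun s => c s * (w s / 2 ^+ k)) a) => //.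
- move=> s; apply: continuousM; [exact: w_continuous|exact: cvg_cst].
- exact: picard_derive.
- move=> s as_; have := w_derive as_ => dw.
  apply: (is_derive_eq (@is_derive_mulr R _ w s 1 _ (2 ^+ k.+1)^-1 dw)).
  by rewrite exprS invfM; field; rewrite expf_neq0.
- by move=> s as_; exact: mul_le.
- by rewrite picard_a// normr0 divr_ge0 ?expR_ge0// exprn_ge0.
Qed.

(** The series converges entrywise, and locally uniformly since [w] is continuous. Its sum [S] is
    differentiated by way of the integral equation S = 1 + int A S. *)
Lemma linear_ode : exists G : R -> 'M[R]_n,
  [/\ G a = 1%:M, forall i j, continuous (fun t => G t i j) &
      forall t, a < t -> forall i j,
        is_derive t 1 (fun s => G s i j) ((A t *m G t) i j)].
Proof.
have /choice[S HS] : forall t, exists M : 'M[R]_n, forall i j N,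
    `|M i j - \sum_(k < N) picard k t i j| <= w t * 2 / 2 ^+ N.
  move=> t; have /choice[f fP] : forall p : 'I_n * 'I_n, exists l, forall N,
      `|l - \sum_(k < N) picard k t p.1 p.2| <= w t * 2 / 2 ^+ N.
    move=> p; apply: (@geometric_series_sum _ (fun k => picard k t p.1 p.2)) => k.
    exact: picard_le.
  by exists (\matrix_(i, j) f (i, j)) => i j N; rewrite mxE (fP (i, j)).
pose SN N t i j := \sum_(k < N) picard k t i j.
have SN_continuous N i j : continuous (fun t => SN N t i j).
  by move=> t; apply: continuous_sum => k; exact: picard_continuous.
have small (b e : R) : 0 < e -> exists N, b / 2 ^+ N < e.
  move=> e0; have : b / 2 ^+ N @[N --> \oo] --> b * 0.
    apply: cvgM; first exact: cvg_cst.
    under eq_fun do rewrite -exprVn.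
    by apply: cvg_expr; rewrite ger0_norm// invf_lt1// ltr1n.
  rewrite mulr0 => /cvgrPdist_lt/(_ _ e0)[N _ HN]; exists N.
  have := HN N (leqnn N); rewrite /= sub0r normrN; exact/le_lt_trans/ler_norm.
have cS i j : continuous (fun t => S t i j).
  move=> t; apply/cvgrPdist_lt => e e0.
  (* [N] is chosen for w t + 1 rather than w t, so that the tail is below e / 3 at every [s] near
     [t] as well. *)
  have [N HN] := small ((w t + 1) * 2) (e / 3) (divr_gt0 e0 (ltr0n _ 3)).
  have wt : \forall s \near t, w s < w t + 1.
    have /cvgrPdist_lt/(_ _ ltr01) := @w_continuous t.
    by apply: filterS => s /=; rewrite distrC => /ltr_distlDr; rewrite addrC.
  have := @SN_continuous N i j t.
  move=> /cvgrPdist_lt/(_ _ (divr_gt0 e0 (ltr0n _ 3))) Nt.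
  near=> s.
  rewrite -[S t i j - S s i j](subrKA (SN N t i j)).
  rewrite -[SN N t i j - S s i j](subrKA (SN N s i j)).
  have H1 : `|S t i j - SN N t i j| < e / 3.
    apply: (le_lt_trans _ HN); apply: (le_trans (HS t i j N)).
    by rewrite ler_pM2r ?invr_gt0 ?exprn_gt0// ler_pM2r// lerDl.
  have H2 : `|SN N t i j - SN N s i j| < e / 3 by near: s.
  have H3 : `|SN N s i j - S s i j| < e / 3.
    rewrite distrC; apply: (le_lt_trans _ HN); apply: (le_trans (HS s i j N)).
    by rewrite ler_pM2r ?invr_gt0 ?exprn_gt0// ler_pM2r// ltW//; near: s.
  rewrite (le_lt_trans (ler_normD _ _))//.
  have := ler_normD (SN N t i j - SN N s i j) (SN N s i j - S s i j).
  lra.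
pose P i j t := prim (fun s => (A s *m S s) i j) t.
have PP i j : [/\ continuous (P i j), forall t, t <= a -> P i j t = 0 &
    forall t, a < t -> is_derive t 1 (P i j) ((A t *m S t) i j)].
  exact: (primP (@mul_continuous _ cS i j)).
have SE t i j : S t i j = (1%:M : 'M[R]_n) i j + P i j t.
  apply/eqP; rewrite -subr_eq0 -normr_le0; apply/ler_addgt0Pr => e e0.
  rewrite add0r; have [N HN] := small (w t * 2) e e0.
  (* Integrating the tail estimate of [S] against [A] gains a factor 2, from w * 2 / 2^N to w / 2^N,
     again by w' = 2 c w. *)
  have D : `|P i j t - \sum_(k < N) picard k.+1 t i j| <= w t / 2 ^+ N.
    have [ta|/ltW at_] := leP t a.
      have [_ -> // _] := PP i j; rewrite big1 => [|k _]; last exact: picard_a.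
      by rewrite subrr normr0 divr_ge0 ?expR_ge0// exprn_ge0.
    apply: (@norm_le_is_derive _ (fun s => P i j s - \sum_(k < N) picard k.+1 s i j)
      (fun s => (A s *m (S s - \matrix_(k, l) SN N s k l)) i j)
      (fun s => w s / 2 ^+ N) (fun s => c s * (w s * 2 / 2 ^+ N)) a) => //.
    - move=> s; apply: (@cvgB _ R^o); first by have [+ _ _] := PP i j; exact.
      by apply: continuous_sum => k; exact: picard_continuous.
    - move=> s; apply: continuousM; [exact: w_continuous|exact: cvg_cst].
    - move=> s as_; apply: is_derive_eq.
        apply: is_deriveB; first by have [_ _] := PP i j; exact.
        by apply: is_derive_bigsum => k; exact: picard_derive.
      rewrite mulmxBr [RHS]mxE [X in _ = _ + X]mxE; congr (_ - _).
      rewrite [RHS]mxE; under [RHS]eq_bigr do rewrite mxE mulr_sumr.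
      by rewrite exchange_big; apply: eq_bigr => k _; rewrite mxE.
    - move=> s as_; have := w_derive as_ => dw.
      apply: (is_derive_eq (@is_derive_mulr R _ w s 1 _ (2 ^+ N)^-1 dw)).
      by ring.
    - by move=> s as_; apply: mul_le => k l; rewrite mxE [X in _ + X]mxE [X in _ - X]mxE; exact: HS.
    - have [_ -> // _] := PP i j; rewrite big1 ?subrr ?normr0.
        by rewrite divr_ge0 ?expR_ge0// exprn_ge0.
      by move=> k _; exact: picard_a.
  (* The increment of index 0 is the identity, so N.+1 increments amount to the identity plus N
     integrated ones. The two errors, each at most w t / 2^N, add up to less than [e]. *)
  have := HS t i j N.+1; rewrite big_ord_recl/= exprS invfM mulrA mulfK//.
  set X := \sum_(k < N) _; have -> : X = \sum_(k < N) picard k.+1 t i j by [].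
  move: D HN; rewrite (_ : w t * 2 / 2 ^+ N = 2 * (w t / 2 ^+ N)); last by ring.
  set Y := \sum_(k < N) _; set d := w t / _ => D HN E.
  have := ler_normB (S t i j - ((1%:M : 'M[R]_n) i j + Y)) (P i j t - Y).
  rewrite (_ : S t i j - _ - _ = S t i j - ((1%:M : 'M[R]_n) i j + P i j t)); last by ring.
  by lra.
exists S; split=> //.
- apply/matrixP => i j; rewrite SE; have [_ -> // _] := PP i j.
  by rewrite addr0.
- move=> t at_ i j; rewrite (_ : (fun s => _) = fun s => (1%:M : 'M[R]_n) i j + P i j s).
    apply: is_derive_eq; last exact: add0r.
    by apply: (is_deriveD (f := cst _)); have [_ _] := PP i j; exact.
  by apply/funext => s; rewrite SE.
Unshelve. all: by end_near. Qed.

End linear_ode.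

(** * Fundamental matrix and Liouville's formula *)

Section fundamental_matrix.
Context {R : realType} {n : nat}.
Implicit Types G H : R -> 'M[R]_n.

Lemma is_derive_mulmx m p q (G : R -> 'M[R]_(m, p)) (H : R -> 'M[R]_(p, q))
    (dG : 'M[R]_(m, p)) (dH : 'M[R]_(p, q)) (t : R) :
  (forall i j, is_derive t 1 (fun s => G s i j) (dG i j)) ->
  (forall i j, is_derive t 1 (fun s => H s i j) (dH i j)) ->
  forall i j, is_derive t 1 (fun s => (G s *m H s) i j) ((dG *m H t + G t *m dH) i j).
Proof.
move=> dGP dHP i j.
rewrite (_ : (fun s => _) = fun s => \sum_k G s i k * H s k j); last first.
  by apply/funext => s; rewrite mxE.
apply: (is_derive_eq (is_derive_bigsum _ (fun k => is_derive_mul (dGP i k) (dHP k j)))).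
rewrite !mxE -big_split; apply: eq_bigr => k _ /=.
by rewrite addrC (mulrC (H t k j)).
Qed.

(** Jacobi's formula: differentiating row k of [G] replaces it by row k of A G, and expansion along
    that row gives (A G adj G)_kk = det G * A_kk. The sum over k is det G * tr A. *)
Lemma is_derive_det G (A : 'M[R]_n) (t : R) : \tr A = 0 ->
  (forall i j, is_derive t 1 (fun s => G s i j) ((A *m G t) i j)) ->
  is_derive t 1 (fun s => \det (G s)) 0.
Proof.
move=> trA dG.
have dD (s : 'S_n) : is_derive t 1 (fun u => (-1) ^+ s * \prod_i G u i (s i))
    (\sum_(k < n) (-1) ^+ s * \prod_(i < n) (if i == k then (A *m G t) i (s i) else G t i (s i))).
  have := is_derive_prod (fun i => dG i (s i)).
  move=> /(@is_derive_mulr _ _ _ _ _ _ ((-1) ^+ s)).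
  under eq_fun do rewrite mulrC.
  by move/is_derive_eq; apply; rewrite mulrC mulr_sumr.
apply: (is_derive_eq (is_derive_bigsum _ dD)).
rewrite exchange_big/=; transitivity (\det (G t) * \tr A); last by rewrite trA mulr0.
rewrite /mxtrace mulr_sumr.
apply: eq_bigr => k _.
pose M := \matrix_(i, j) (if i == k then (A *m G t) i j else G t i j).
transitivity (\det M).
  by apply: eq_bigr => s _; congr (_ * _); apply: eq_bigr => i _; rewrite [RHS]mxE.
rewrite (expand_det_row _ k).
transitivity (\sum_j (A *m G t) k j * cofactor (G t) k j).
  apply: eq_bigr => j _; rewrite [M k j]mxE eqxx; congr (_ * _).
  rewrite /cofactor; congr (_ * \det _); apply/matrixP => i l; rewrite !mxE.
  by rewrite eq_sym (negbTE (neq_lift _ _)).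
transitivity ((A *m G t *m \adj (G t)) k k).
  by rewrite mxE; apply: eq_bigr => j _; rewrite [X in _ = _ * X]mxE.
by rewrite -mulmxA mul_mx_adj mul_mx_scalar mxE.
Qed.

(** [H] is the transpose of a solution of the adjoint equation K' = - A^T K, so its derivative is
    known by construction. It inverts [G] because H G has derivative zero and starts at the
    identity. *)
Lemma fundamental_matrix (A : R -> 'M[R]_n) (a : R) :
  (forall i j, continuous (fun t => A t i j)) -> (forall t, \tr (A t) = 0) ->
  exists G H : R -> 'M[R]_n,
    [/\ forall t, a <= t -> H t *m G t = 1%:M,
        forall t, a <= t -> \det (G t) = 1,
        forall t, a < t -> forall i j,
          is_derive t 1 (fun s => G s i j) ((A t *m G t) i j) &
        forall t, a < t -> forall i j,
          is_derive t 1 (fun s => H s i j) ((- (H t *m A t)) i j)].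
Proof.
move=> cA trA; have [G [Ga cG dG]] := linear_ode a cA.
have [|K [Ka cK dK]] := @linear_ode R n (fun t => - (A t)^T) a.
  move=> i j; rewrite (_ : (fun t => _) = fun t => - (A t j i)).
    by move=> t; apply: (@cvgN _ R^o); exact: cA.
  by apply/funext => t; rewrite !mxE.
have dH t : a < t -> forall i j,
    is_derive t 1 (fun s => (K s)^T i j) ((- ((K t)^T *m A t)) i j).
  move=> at_ i j; under eq_fun do rewrite mxE.
  apply: (is_derive_eq (dK t at_ j i)).
  by rewrite -[in RHS](trmxK (A t)) -trmx_mul mulNmx !mxE.
exists G, (fun t => (K t)^T); split => //.
- move=> t at_; apply/matrixP => i j.
  rewrite [RHS](_ : _ = ((K a)^T *m G a) i j); last by rewrite Ka Ga trmx1 mul1mx.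
  apply: (@is_derive_eq0_cst _ (fun t => ((K t)^T *m G t) i j) a) => //.
    rewrite (_ : (fun t => _) = fun t => \sum_k (K t k i) * G t k j).
      by move=> s; apply: continuous_sum => k; apply: continuousM; [exact: cK|exact: cG].
    by apply/funext => s; rewrite mxE; apply: eq_bigr => k _; rewrite mxE.
  move=> s as_; apply: (is_derive_eq (is_derive_mulmx (dH s as_) (dG s as_) i j)).
  by rewrite mulNmx mulmxA addNr mxE.
- move=> t at_; rewrite -[RHS](det1 R n) -Ga.
  apply: (@is_derive_eq0_cst _ (fun t => \det (G t)) a) => //.
    move=> s; apply: continuous_sum => p; apply: continuousM; first exact: cvg_cst.
    by apply: (@cvg_big R^o _ *%R 1 xpredT) => [z|i _]; [exact: mul_continuous|exact: cG].
  by move=> s as_; apply: (is_derive_det (trA s)) => i j; exact: dG.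
Qed.

End fundamental_matrix.

(** * Differentiable functions on the sphere *)

Section matrix_calculus.
Context {R : realType}.

Lemma mx_cvg (T : Type) (F : set_system T) (FF : Filter F) m n
    (f : T -> 'M[R]_(m, n)) (l : 'M[R]_(m, n)) :
  (forall i j, f x i j @[x --> F] --> l i j) -> f x @[x --> F] --> l.
Proof.
move=> fl; apply/cvgrPdist_le => /= e e0; near=> x.
rewrite /Num.Def.normr/= mx_normrE (bigmax_le _ (ltW e0))//= => i _.
rewrite !mxE/=; move: i; near: x; apply: filter_forall => /= i.
exact: ((cvgrPdist_le _ _).1 (fl i.1 i.2)).
Unshelve. all: by end_near. Qed.

Lemma cvg_coord (T : Type) (F : set_system T) (FF : Filter F) m n
    (f : T -> 'M[R]_(m, n)) (l : 'M[R]_(m, n)) i j :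
  f x @[x --> F] --> l -> f x i j @[x --> F] --> l i j.
Proof.
move=> fl; apply: (@cvg_comp _ _ _ f (fun M : 'M[R]_(m, n) => M i j) _ (nbhs l)) => //.
exact: coord_continuous.
Qed.

Lemma cvg_bigsum (T : Type) (F : set_system T) (FF : Filter F) I (r : seq I)
    (f : I -> T -> R) (l : I -> R) :
  (forall i, f i x @[x --> F] --> l i) ->
  \sum_(i <- r) f i x @[x --> F] --> \sum_(i <- r) l i.
Proof.
by move=> fl; apply: (@cvg_big R^o _ +%R 0 xpredT) => [z|i _]; [exact: add_continuous|exact: fl].
Qed.

Lemma cvg_mulmx (T : Type) (F : set_system T) (FF : Filter F) m n p
    (f : T -> 'M[R]_(m, n)) (g : T -> 'M[R]_(n, p)) (k : 'M[R]_(m, n)) (l : 'M[R]_(n, p)) :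
  f x @[x --> F] --> k -> g x @[x --> F] --> l ->
  (f x *m g x) @[x --> F] --> k *m l.
Proof.
move=> fk gl; apply: mx_cvg => i j; rewrite mxE.
under eq_fun do rewrite mxE.
by apply: cvg_bigsum => q; apply: cvgM; exact: cvg_coord.
Qed.

Lemma cvg_trmx (T : Type) (F : set_system T) (FF : Filter F) m n
    (f : T -> 'M[R]_(m, n)) (k : 'M[R]_(m, n)) :
  f x @[x --> F] --> k -> (f x)^T @[x --> F] --> k^T.
Proof.
move=> fk; apply: mx_cvg => i j; rewrite mxE.
by under eq_fun do rewrite mxE; exact: cvg_coord.
Qed.

Lemma enorm_continuous n : continuous (@enorm R n).
Proof.
move=> x; apply: (@continuous_comp _ _ _ (fun x : 'cV[R]_n => \sum_i x i ord0 ^+ 2) Num.sqrt).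
  apply: continuous_sum => i.
  apply: (@continuous_comp _ _ _ (fun x : 'cV[R]_n => x i ord0) (fun u => u ^+ 2)).
    exact: coord_continuous.
  exact: sqr_continuous.
exact: sqrt_continuous.
Qed.

Lemma coord_le_enorm n (x : 'cV[R]_n) i : `|x i ord0| <= enorm x.
Proof.
rewrite -sqrtr_sqr ler_wsqrtr// (bigD1 i)//= lerDl.
by apply: sumr_ge0 => j _; exact: sqr_ge0.
Qed.

Lemma enorm_ge0 n (x : 'cV[R]_n) : 0 <= enorm x.
Proof. exact: sqrtr_ge0. Qed.

Lemma normr_le_enorm n (x : 'cV[R]_n) : `|x| <= enorm x.
Proof.
rewrite /Num.Def.normr/= mx_normrE; apply: bigmax_le => [|[i j] _].
  exact: enorm_ge0.
by rewrite (ord1 j) coord_le_enorm.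
Qed.

Lemma usphere_compact n : compact (usphere R n).
Proof.
(* [bounded_closed_compact] speaks of row vectors, hence the transposition. *)
pose K := [set v : 'rV[R]_n | enorm v^T = 1].
have -> : usphere R n = trmx @` K.
  apply/seteqP; split => [x x1|_ [v v1 <-]]; last exact: v1.
  by exists x^T; rewrite /K/= ?trmxK.
apply: continuous_compact.
  by apply: continuous_subspaceT => v; apply: (@cvg_trmx _ (nbhs v) _ 1 n id).
apply: bounded_closed_compact.
  exists 1; split; first by rewrite num_real.
  move=> M M1 v v1; rewrite /K/= in v1.
  rewrite /= (le_trans _ (ltW M1))// -v1.
  rewrite /Num.Def.normr/= mx_normrE; apply: bigmax_le => [|[i j] _].
    exact: enorm_ge0.
  by rewrite (ord1 i)/=; have := coord_le_enorm v^T j; rewrite mxE.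
rewrite (_ : K = (fun v : 'rV[R]_n => enorm v^T) @^-1` [set 1])//.
apply: closed_comp => [v _|]; last exact: closed_eq.
apply: (@continuous_comp _ _ _ trmx (@enorm R n)).
  exact: (@cvg_trmx _ (nbhs v) _ 1 n id).
exact: enorm_continuous.
Qed.

End matrix_calculus.

Lemma near_eq_differentiable (K : numFieldType) (V W : normedModType K)
    (f g : V -> W) (x : V) :
  (\near x, f x = g x) -> differentiable f x -> differentiable g x.
Proof.
move=> fg df; have fgx := nbhs_singleton fg.
move/diff_locallyP : df => [cdf /eqaddoP E].
have G : g \o shift x = cst (g x) + 'd f x +o_ 0 id.
  apply/eqaddoP => e e0; have := E e e0.
  have := fg; rewrite (near_shift 0 x) subr0 => fg0; apply: filterS2 fg0 => h /= fgh.
  by rewrite ![(_ - _) h]/= !fctE/= -fgx fgh.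
apply/diff_locallyP; rewrite (diff_unique cdf G).
by split.
Qed.

Lemma near_eq_continuous (T U : topologicalType) (f g : T -> U) (x : T) :
  (\near x, f x = g x) -> {for x, continuous f} -> {for x, continuous g}.
Proof.
move=> fg cf; rewrite /prop_for /continuous_at -(nbhs_singleton fg).
by apply: cvg_trans cf; exact: near_eq_cvg.
Qed.

Section gradient.
Context {R : realType} {n : nat}.
Notation V := 'cV[R]_n.
Implicit Types (f g : V -> R) (x v : V).

Lemma derive_grad f x v : differentiable f x ->
  'D_v f x = ((grad f x)^T *m v) ord0 ord0.
Proof.
move=> df; rewrite deriveE// mxE [in LHS](matrix_sum_delta v).
rewrite linear_sum/=; apply: eq_bigr => i _.
by rewrite big_ord1 linearZ/= !mxE deriveE// mulrC.
Qed.

Lemma is_derive_curve f (c : R -> V) (c' : V) (t : R) :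
  (forall i, is_derive t 1 (fun s => c s i ord0) (c' i ord0)) ->
  differentiable f (c t) ->
  is_derive t 1 (fun s => f (c s)) (((grad f (c t))^T *m c') ord0 ord0).
Proof.
move=> dc df.
have dct : derivable c t 1.
  by apply/derivable_mxP => i j; rewrite (ord1 j); have [] := dc i.
have Dc : differentiable c t by exact/derivable1_diffP.
apply: DeriveDef.
  by apply/derivable1_diffP; apply: (@differentiable_comp _ _ _ _ c f).
rewrite (@deriveE _ _ _ (f \o c))//; last exact: differentiable_comp.
rewrite diff_comp//= -(deriveE _ Dc) derive_mx//.
rewrite (_ : \matrix_(_, _) _ = c'); last first.
  by apply/colP => i; rewrite mxE (derive_val (is_derive := dc i)).
by rewrite -deriveE// derive_grad.
Qed.

End gradient.

Section gradient_theory.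
Context {R : realType}.

Lemma mulmx_continuous m n (M : 'M[R]_(m, n)) : continuous (fun v : 'cV[R]_n => M *m v).
Proof.
move=> v; apply: (@cvg_mulmx _ _ (nbhs v) _ m n 1 (fun=> M) id M v).
  exact: cvg_cst.
exact: cvg_id.
Qed.

Lemma differentiable_mulmx m n (M : 'M[R]_(m, n)) (x : 'cV[R]_n) :
  differentiable (mulmx M : 'cV[R]_n -> 'cV[R]_m) x.
Proof. by apply: linear_differentiable; exact: mulmx_continuous. Qed.

Lemma grad_mulmx m n (f : 'cV[R]_m -> R) (M : 'M[R]_(m, n)) (x : 'cV[R]_n) :
  differentiable f (M *m x) ->
  grad (fun y => f (M *m y)) x = M^T *m grad f (M *m x).
Proof.
move=> df; apply/colP => i; rewrite mxE.
have dM := differentiable_mulmx M x.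
rewrite (@deriveE _ _ _ (f \o mulmx M)); last exact: differentiable_comp.
rewrite diff_comp//= diff_lin; last exact: mulmx_continuous.
transitivity ('D_(M *m delta_mx i ord0) f (M *m x)); first by rewrite deriveE.
rewrite derive_grad//= -colE !mxE; apply: eq_bigr => k _.
by rewrite !mxE mulrC.
Qed.

End gradient_theory.

Section C1_functions.
Context {R : realType} {n : nat}.
Notation V := 'cV[R]_n.
Implicit Types (f g : V -> R) (x v : V).

Lemma near_eq_grad f g x : (\near x, f x = g x) -> grad f x = grad g x.
Proof. by move=> fg; apply/colP => i; rewrite !mxE; exact: near_eq_derive. Qed.

(** Differentiability is required near [x] and not only at [x]: the formulas for the gradient of a
    sum, product or composite then hold on a neighbourhood, which is what continuity of the gradient
    at [x] involves. *)
Definition C1_at f x :=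
  (\forall y \near x, differentiable f y) /\ {for x, continuous (grad f)}.

Lemma C1_at_near f g x : (\near x, f x = g x) -> C1_at f x -> C1_at g x.
Proof.
move=> fg [df cf]; have fg' := near_join fg; split.
  by near=> y; apply: (@near_eq_differentiable _ _ _ f g y); near: y.
apply: near_eq_continuous cf.
by near=> y; apply: near_eq_grad; near: y.
Unshelve. all: by end_near. Qed.

Lemma C1_at_cst (c : R) x : C1_at (cst c) x.
Proof.
split; first by near=> y; exact: differentiable_cst.
rewrite (_ : grad (cst c) = cst 0); first exact: cst_continuous.
by apply/funext => y; apply/colP => i; rewrite !mxE derive_cst.
Unshelve. all: by end_near. Qed.

Lemma C1_at_coord i x : C1_at (fun y => y i ord0) x.
Proof.
split; first by near=> y; exact: differentiable_coord.
rewrite (_ : grad _ = cst (delta_mx i ord0)); first exact: cst_continuous.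
apply/funext => y; apply/colP => j; rewrite mxE.
have := derive_mx (@derivable_id R _ y (delta_mx j ord0 : V)).
rewrite derive_id => /matrixP/(_ i ord0); rewrite [RHS]mxE => <-.
by rewrite !mxE eq_sym.
Unshelve. all: by end_near. Qed.

Lemma C1_atD f g x : C1_at f x -> C1_at g x -> C1_at (fun y => f y + g y) x.
Proof.
move=> [df cf] [dg cg]; split.
  by near=> y; apply: differentiableD; near: y.
have E y : differentiable f y -> differentiable g y ->
    grad (fun y => f y + g y) y = grad f y + grad g y.
  move=> dfy dgy; apply/colP => i; rewrite !mxE.
  by rewrite -deriveD//; exact: diff_derivable.
apply: (@near_eq_continuous _ _ (fun y => grad f y + grad g y)).
  by near=> y; apply/esym/E; near: y.
exact: (continuousD cf cg).
Unshelve. all: by end_near. Qed.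

Lemma C1_atM f g x : C1_at f x -> C1_at g x -> C1_at (fun y => f y * g y) x.
Proof.
move=> [df cf] [dg cg]; split.
  by near=> y; apply: differentiableM; near: y.
have E y : differentiable f y -> differentiable g y ->
    grad (fun y => f y * g y) y = f y *: grad g y + g y *: grad f y.
  move=> dfy dgy; apply/colP => i; rewrite !mxE.
  by rewrite [LHS](@deriveM _ _ f g)//; exact: diff_derivable.
apply: (@near_eq_continuous _ _ (fun y => f y *: grad g y + g y *: grad f y)).
  by near=> y; apply/esym/E; near: y.
have cfx := differentiable_continuous (nbhs_singleton df).
have cgx := differentiable_continuous (nbhs_singleton dg).
exact: (continuousD (continuousZ cfx cg) (continuousZ cgx cf)).
Unshelve. all: by end_near. Qed.

Lemma C1_at_comp f (h h' : R -> R) x : C1_at f x ->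
  (\forall u \near f x, is_derive (u : R) 1 h (h' u)) -> {for f x, continuous h'} ->
  C1_at (fun y => h (f y)) x.
Proof.
move=> [df cf] dh ch'.
have cfx := differentiable_continuous (nbhs_singleton df).
have dhf : \forall y \near x, is_derive (f y) 1 h (h' (f y)) by exact: (cfx _ dh).
have D y : is_derive (f y) 1 h (h' (f y)) -> differentiable h (f y).
  by case=> + _ => /derivable1_diffP.
split.
  near=> y; apply: (@differentiable_comp _ _ _ _ f h); first by near: y.
  by apply: D; near: y.
have E y : differentiable f y -> is_derive (f y) 1 h (h' (f y)) ->
    grad (fun y => h (f y)) y = h' (f y) *: grad f y.
  move=> dfy dhy; have Dh := D _ dhy; apply/colP => i; rewrite !mxE.
  rewrite (@deriveE _ _ _ (h \o f)); last exact: differentiable_comp.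
  rewrite diff_comp//= [X in 'd h _ X](_ : _ = 'D_(delta_mx i ord0) f y); last by rewrite deriveE.
  rewrite diff1E// derive1E.
  by rewrite (derive_val (is_derive := dhy)) mulrC.
apply: (@near_eq_continuous _ _ (fun y => h' (f y) *: grad f y)).
  by near=> y; apply/esym/E; near: y.
exact: (continuousZ (continuous_comp cfx ch') cf).
Unshelve. all: by end_near. Qed.

Lemma C1_at_sum I (r : seq I) (F : I -> V -> R) x : (forall i, C1_at (F i) x) ->
  C1_at (fun y => \sum_(i <- r) F i y) x.
Proof.
move=> F1; elim: r => [|i r IH].
  rewrite (_ : (fun y => _) = cst 0); first exact: C1_at_cst.
  by apply/funext => y; rewrite big_nil.
rewrite (_ : (fun y => _) = fun y => F i y + \sum_(i <- r) F i y).
  exact: (C1_atD (F1 i) IH).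
by apply/funext => y; rewrite big_cons.
Qed.

End C1_functions.

(** * C1 functions on the sphere through their radial extensions *)

Section radial_extension.
Context {R : realType} {n : nat}.
Notation V := 'cV[R]_n.+1.
Implicit Types (x v : V) (phi : sphere R n -> R).

Lemma enorm_gt0 x : (0 < enorm x) = (x != 0).
Proof. by rewrite lt0r enorm_eq0 sqrtr_ge0 andbT. Qed.

Lemma near_neq0 x : x != 0 -> \forall y \near x, y != 0.
Proof.
rewrite -enorm_gt0 => x0; have := @enorm_continuous R _ x.
move=> /cvgr_gt/(_ _ x0); apply: filterS => y; by rewrite enorm_gt0.
Qed.

Lemma C1_at_invnorm x : x != 0 -> C1_at (fun y : V => (enorm y)^-1) x.
Proof.
move=> x0; pose q (y : V) : R := \sum_i y i ord0 * y i ord0.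
have qE (y : V) : enorm y = Num.sqrt (q y).
  by rewrite /enorm; congr Num.sqrt; apply: eq_bigr => i _; rewrite expr2.
have -> : (fun y : V => (enorm y)^-1) = fun y => (Num.sqrt (q y))^-1.
  by apply/funext => y; rewrite qE.
have qx : 0 < q x by rewrite -sqrtr_gt0 -qE enorm_gt0.
have C1q : C1_at q x by apply: C1_at_sum => i; apply: C1_atM; exact: C1_at_coord.
have nq : \forall u \near q x, 0 < u by exact: lt_nbhsr.
apply: (@C1_at_comp _ _ q (fun u => (Num.sqrt u)^-1)
  (fun u => - (Num.sqrt u) ^- 2 * (2 * Num.sqrt u)^-1) x C1q).
  near=> u; have u0 : 0 < u by near: u.
  have su0 : Num.sqrt u != 0 by rewrite gt_eqF// sqrtr_gt0.
  exact: (is_deriveV su0 (is_derive1_sqrt u0)).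
have cs : {for q x, continuous (@Num.sqrt R)} by exact: sqrt_continuous.
have s0 : Num.sqrt (q x) != 0 by rewrite gt_eqF// sqrtr_gt0.
apply: continuousM.
  apply: continuousN; apply: continuousV; first by rewrite expf_neq0.
  exact: (continuous_comp cs (@exprn_continuous R 2 _)).
apply: continuousV; first by rewrite mulf_neq0.
by apply: continuousM; [exact: cst_continuous|exact: cs].
Unshelve. all: by end_near. Qed.

Lemma radial_extE phi (f : V -> R) :
  (forall x, x != 0 -> phi (normalize x) = f x) ->
  (forall x, x != 0 -> C1_at f x) -> C1_sphere phi.
Proof.
move=> E C x x0.
have fphi : \near x, f x = radial_ext phi x.
  by apply: filterS (near_neq0 x0) => y y0; rewrite /radial_ext E.
have [d c] := C1_at_near fphi (C x x0).
by split => //; exact: (nbhs_singleton d).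
Qed.

(** With b = x_i - a_i, the exponent k - k^2 b tends to minus infinity for b > 0 and is at least k
    for b <= 0. The linear term k decides the boundary case b = 0. *)
Definition orthant_test (a : 'I_n.+1 -> R) (k : nat) (x : sphere R n) : R :=
  expR (- \sum_i expR (k%:R - k%:R ^+ 2 * (val x i ord0 - a i))).

Lemma C1_orthant_test a k : C1_sphere (orthant_test a k).
Proof.
apply: (@radial_extE _ (fun x => expR (-1 * \sum_i expR (k%:R +
    - k%:R ^+ 2 * ((enorm x)^-1 * x i ord0 + - a i))))) => x x0.
  rewrite /orthant_test val_normalize (negbTE x0) mulN1r; congr (expR (- _)).
  by apply: eq_bigr => i _; rewrite mxE mulNr.
have Ce (f : V -> R) : C1_at f x -> C1_at (fun y => expR (f y)) x.
  move=> Cf; apply: (@C1_at_comp _ _ f expR expR x Cf); last exact: continuous_expR.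
  by near=> u; exact: is_derive_expR.
apply: (Ce); apply: C1_atM; first exact: C1_at_cst.
apply: C1_at_sum => i; apply: (Ce); apply: C1_atD; first exact: C1_at_cst.
apply: C1_atM; first exact: C1_at_cst.
apply: C1_atD; last exact: C1_at_cst.
by apply: C1_atM; [exact: C1_at_invnorm|exact: C1_at_coord].
Unshelve. all: by end_near. Qed.

Lemma orthant_test_cvg a (x : sphere R n) : orthant_test a k x @[k --> \oo] -->
  (\1_[set x : sphere R n | forall i, a i < val x i ord0] x : R).
Proof.
rewrite indicE; case: (boolP (_ \in _)) => [/set_mem/= ax|xa].
  have -> : (true%:R : R) = expR (- \sum_(i < n.+1) 0).
    by rewrite big1 ?oppr0 ?expR0.
  apply: (@cvg_comp _ _ _ (fun k : nat => - \sum_i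
      expR (k%:R - k%:R ^+ 2 * (val x i ord0 - a i))) expR); last exact: continuous_expR.
  apply: (@cvgN _ R^o); apply: cvg_bigsum => i.
  have b0 : 0 < val x i ord0 - a i by rewrite subr_gt0.
  apply: squeeze_cvgr; [|exact: cvg_cst|exact: (@cvgn_expR R)].
  near=> k; rewrite expR_ge0/= ler_expR.
  (* From 2 <= k b follows k - k^2 b <= - k. *)
  have kb : 2 / (val x i ord0 - a i) <= k%:R by near: k; exact: nbhs_infty_ger.
  rewrite ler_pdivrMr// in kb; rewrite expr2.
  have := ler_wpM2l (ler0n R k) kb; lra.
have /existsNP[i /negP xi] : ~ forall i, a i < val x i ord0.
  by move=> H; move/negP: xa; apply; apply/mem_set.
apply: squeeze_cvgr; [|exact: cvg_cst|exact: (@cvgn_expR R)].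
near=> k; rewrite expR_ge0/= ler_expR lerN2.
apply: (@le_trans _ _ (expR (k%:R - k%:R ^+ 2 * (val x i ord0 - a i)))).
  apply: (@le_trans _ _ (expR k%:R)).
    by rewrite (le_trans _ (expR_ge1Dx _))// lerDr.
  rewrite ler_expR lerBrDr gerDl -oppr_ge0 -mulrN mulr_ge0 ?sqr_ge0//.
  by rewrite oppr_ge0 subr_le0 leNgt.
rewrite (bigD1 i)//= lerDl sumr_ge0// => j _; exact: expR_ge0.
Unshelve. all: by end_near. Qed.

End radial_extension.

Section sphere_functions.
Context {R : realType} {n : nat}.
Notation V := 'cV[R]_n.+1.
Notation S := (sphere R n).
Implicit Types (F : V -> R) (x y : S).

(** Continuity in the ambient space, asked only at unit vectors: radial extensions satisfy it,
    although they may jump at the origin. *)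
Definition cts_sphere F := forall v : V, enorm v = 1 -> {for v, continuous F}.

Lemma enorm_val x : enorm (val x) = 1.
Proof. exact: set_mem (valP x). Qed.

Lemma val_neq0 x : val x != 0.
Proof. by rewrite -enorm_eq0 enorm_val oner_eq0. Qed.

Lemma normalize_val x : normalize (val x) = x.
Proof.
by apply: val_inj; rewrite val_normalize (negbTE (val_neq0 x)) enorm_val invr1 scale1r.
Qed.

Lemma measurable_cts F : cts_sphere F ->
  measurable_fun [set: S] (fun x => F (val x) : measurableTypeR R).
Proof.
move=> cF; apply: (measurability _ (RGenOpens.measurableE R)).
move=> _ [_ [a [b ->] <-]]; rewrite setTI; apply: sub_sigma_algebra.
have cf : continuous (fun x : S => F (val x)).
  have cv : continuous (val : S -> V) by exact: initial_continuous.
  by move=> x; exact: (continuous_comp (cv x) (cF _ (enorm_val x))).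
by have /continuousP := cf; apply; exact: interval_open.
Qed.

Lemma cts_bounded F : cts_sphere F ->
  exists2 M : R, 0 <= M & forall v : V, enorm v = 1 -> `|F v| <= M.
Proof.
move=> cF; have /compact_near_coveringP/near_covering_withinP cK := @usphere_compact R n.+1.
have : \forall M \near +oo, usphere R n.+1 `<=` (fun v : V => `|F v| <= M).
  apply: cK => v v1; have cv := cF _ v1.
  exists ([set w | `|F w| < `|F v| + 1], [set M | `|F v| + 1 < M]) => /=.
    split; last by apply: nbhs_pinfty_gt; rewrite num_real.
    by apply: (cvgr_lt _ (cvg_norm cv)); rewrite ltrDl.
  by move=> [w M] /= [H1 H2] _; apply: ltW; exact: lt_trans H1 H2.
move=> [M [_ HM]]; exists (Num.max (M + 1) 0); first by rewrite le_max lexx orbT.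
move=> v v1; apply: HM => //.
by rewrite lt_max ltrDl ltr01.
Qed.

Lemma integrable_cts (mu : probability S R) F : cts_sphere F ->
  mu.-integrable [set: S] (EFin \o (fun x => F (val x))).
Proof.
move=> cF; have [M M0 FM] := cts_bounded cF.
apply: measurable_bounded_integrable => //.
- by apply: (le_lt_trans (probability_le1 mu measurableT)); rewrite ltry.
- exact: measurable_cts.
exists M; split; first by rewrite num_real.
by move=> N MN x _ /=; rewrite (le_trans (FM _ (enorm_val x)))// ltW.
Qed.

Lemma le_normr_integral_cts (mu : probability S R) F (e : R) : cts_sphere F ->
  (forall v : V, enorm v = 1 -> `|F v| <= e) -> `|\int[mu]_x F (val x)| <= e.
Proof.
move=> cF Fe; have iF := integrable_cts mu cF.
rewrite (le_trans (le_normr_Rintegral _ iF))//.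
have <- : \int[mu]_(x in [set: S]) e = e.
  rewrite Rintegral_cst// [X in fine X](_ : _ = 1%E) ?mulr1//.
    exact: probability_setT.
apply: le_Rintegral => //.
- have := @integrable_cts mu (fun v => `|F v|); apply => v v1.
  by apply: (continuous_comp (cF v v1)); exact: norm_continuous.
- by apply: (@integrable_cts mu (cst e)) => v _; exact: cst_continuous.
- by move=> x _; apply: Fe; exact: enorm_val.
Qed.

(** Uniform continuity in affine form: values at points closer than d / 2 differ by less than [e],
    and for other pairs C |v - w| is at least 2 M, with M a bound of |F|. This lets [W1] control the
    integral of any continuous function. *)
Lemma cts_modulus F (e : R) : cts_sphere F -> 0 < e ->
  exists2 C : R, 0 <= C & forall v w : V, enorm v = 1 -> enorm w = 1 ->
    `|F v - F w| <= e + C * enorm (v - w).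
Proof.
move=> cF e0; have [M M0 FM] := cts_bounded cF.
have /compact_near_coveringP/near_covering_withinP cK := @usphere_compact R n.+1.
have : \forall d \near (0 : R)^'+, usphere R n.+1 `<=` (fun v : V =>
    forall w : V, enorm w = 1 -> enorm (v - w) < d -> `|F v - F w| < e).
  apply: cK => v v1; have cv := cF _ v1.
  have /cvgrPdist_lt/(_ _ (divr_gt0 e0 (ltr0n _ 2))) := cv.
  move=> /nbhs_ballP[r /= r0 rP]; rewrite -ball_normE/= in rP.
  have r20 : 0 < r / 2 by rewrite divr_gt0.
  exists (ball v (r / 2), [set d | d < r / 2]) => /=.
    by split; [exact: nbhsx_ballx|exact: nbhs_right_lt].
  move=> [u d] /= [vu dr] u1 w w1 uw; rewrite -ball_normE/= in vu.
  have H1 : `|F v - F u| < e / 2.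
    by apply: rP; rewrite /= (lt_le_trans vu)// ler_pdivrMr// ler_peMr ?ler1n// ltW.
  have H2 : `|F v - F w| < e / 2.
    apply: rP => /=; rewrite -(subrKA u) (splitr r) (le_lt_trans (ler_normD _ _))//.
    by rewrite ltrD// (le_lt_trans (normr_le_enorm _))// (lt_trans uw).
  rewrite -(subrKA (F v)) (splitr e) (le_lt_trans (ler_normD _ _))// ltrD//.
  by rewrite distrC.
move=> [d /= d0 dP].
have d20 : 0 < d / 2 by rewrite divr_gt0.
exists (2 * M / (d / 2)); first by rewrite divr_ge0 ?mulr_ge0// ltW.
move=> v w v1 w1; have [vw|vw] := ltP (enorm (v - w)) (d / 2).
  have : `|F v - F w| < e.
    apply: (dP (d / 2)) => //=.
    by rewrite sub0r normrN gtr0_norm// ltr_pdivrMr// ltr_pMr// ltr1n.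
  move/ltW/le_trans; apply; rewrite lerDl mulr_ge0 ?enorm_ge0//.
  by rewrite divr_ge0 ?mulr_ge0// ltW.
rewrite (le_trans (ler_normB _ _))//.
rewrite -[leLHS]add0r lerD ?(ltW e0)//.
rewrite mulrAC ler_pdivlMr// ler_pM ?addr_ge0//; first exact: ltW.
by have := FM _ v1; have := FM _ w1; lra.
Qed.

Lemma radial_ext_cts (phi : S -> R) : C1_sphere phi -> cts_sphere (radial_ext phi).
Proof.
move=> C v v1; have v0 : v != 0 by rewrite -enorm_eq0 v1 oner_eq0.
by have [/differentiable_continuous] := C _ v0.
Qed.

Lemma radial_ext_val (phi : S -> R) x : radial_ext phi (val x) = phi x.
Proof. by rewrite /radial_ext normalize_val. Qed.

Lemma measurable_C1_sphere (phi : S -> R) : C1_sphere phi ->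
  measurable_fun [set: S] (phi : S -> measurableTypeR R).
Proof.
move=> /radial_ext_cts/measurable_cts.
by under eq_fun do rewrite radial_ext_val.
Qed.

(** The sets [O a] are stable under intersection and generate the Borel sets; dominated convergence
    along [orthant_test] gives both measures the same value on each of them. *)
Lemma C1_sphere_determines (mu nu : probability S R) :
  (forall phi : S -> R, C1_sphere phi -> \int[mu]_x phi x = \int[nu]_x phi x) ->
  mu ≡μ nu.
Proof.
move=> E.
pose O (a : 'I_n.+1 -> R) := [set x : S | forall i, a i < val x i ord0].
have mcoord i : measurable_fun [set: S] (fun x => val x i ord0 : measurableTypeR R).
  by apply: (@measurable_cts (fun v => v i ord0)) => v _; exact: coord_continuous.
have mO a : measurable (O a).
  rewrite (_ : O a = \bigcap_(i in [set: 'I_n.+1])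
      ((fun x : S => val x i ord0) @^-1` `]a i, +oo[)).
    apply: fin_bigcap_measurable => // i _.
    by rewrite -[X in measurable X]setTI; exact: mcoord.
  apply/seteqP; split => [x Ox i _ /=|x Ox i]; first by rewrite in_itv/= andbT.
  by have := Ox i Logic.I; rewrite /= in_itv/= andbT.
have EO a : mu (O a) = nu (O a).
  have lim (m : probability S R) :
      (\int[m]_x (orthant_test a k x)%:E)%E @[k --> \oo] --> m (O a).
    have mt k : measurable_fun [set: S] (fun x => (orthant_test a k x)%:E).
      by apply/measurable_EFinP; apply: measurable_C1_sphere; exact: C1_orthant_test.
    have mi : measurable_fun [set: S] (fun x => (\1_(O a) x)%:E : \bar R).
      by apply/measurable_EFinP; exact: measurable_indic.
    have i1 : m.-integrable [set: S] (cst 1%E).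
      have := @integrable_cts m (cst 1); apply => v _; exact: cst_continuous.
    have [||_ _] := @dominated_convergence _ _ _ m _ measurableT
      (fun k x => (orthant_test a k x)%:E) (fun x => (\1_(O a) x)%:E) (cst 1%E) mt mi _ i1.
    - apply: aeW => x _; apply/fine_cvgP; split; first by near=> k.
      exact: orthant_test_cvg.
    - apply: aeW => x k _; rewrite /= lee_fin ger0_norm ?expR_ge0//.
      by rewrite -[leRHS](@expR0 R) ler_expR oppr_le0 sumr_ge0// => i _; exact: expR_ge0.
    by rewrite integral_indic// setIT.
  have e k : (\int[mu]_x (orthant_test a k x)%:E = \int[nu]_x (orthant_test a k x)%:E)%E.
    have fin (m : probability S R) : (\int[m]_x (orthant_test a k x)%:E)%E \is a fin_num.
      apply: integrable_fin_num => //.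
      have := integrable_cts m (radial_ext_cts (C1_orthant_test a k)).
      by under eq_fun do rewrite radial_ext_val.
    rewrite -(fineK (fin mu)) -(fineK (fin nu)).
    by congr EFin; exact: (E _ (C1_orthant_test a k)).
  have l1 := lim mu; rewrite (funext e) in l1.
  exact: (cvg_unique _ l1 (lim nu)).
(* Coordinates on the sphere lie in [-1, 1], so - 2 stands for minus infinity. *)
have O2 : O (fun=> - 2) = setT.
  apply/seteqP; split => // x _ i; have := coord_le_enorm (val x) i.
  rewrite enorm_val ler_norml => /andP[+ _]; apply: lt_le_trans.
  by rewrite ltrN2 ltr1n.
pose G := [set O a | a in [set: 'I_n.+1 -> R]].
move=> A mA; apply: (measure_unique G (fun=> setT)) => //.
- apply/seteqP; split.
    apply: smallest_sub; first exact: smallest_sigma_algebra.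
    move=> _ [U oU <-].
    apply: (@measurable_open_preimage R _ (g_sigma_algebraType G) n.+1
      (fun x : S => val x)) => // i.
    apply: (measurability _ (RGenOInfty.measurableE R)) => _ [_ [b ->] <-].
    rewrite setTI; apply: sub_sigma_algebra.
    exists (fun j => if j == i then b else - 2) => //.
    apply/seteqP; split => [x Ox /=|x /= + j].
      by have := Ox i; rewrite eqxx in_itv/= andbT.
    rewrite in_itv/= andbT => bx; case: eqP => [->//|_].
    by have : O (fun=> - 2) x by rewrite O2.
  apply: smallest_sub; first exact: sigma_algebra_measurable.
  by move=> _ [a _ <-]; exact: mO.
- move=> _ _ [a _ <-] [b _ <-]; exists (fun i => Num.max (a i) (b i)) => //.
  apply/seteqP; split => [x Ox|x [Oa Ob] i]; last by rewrite gt_max Oa Ob.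
  by split => i; have := Ox i; rewrite gt_max => /andP[].
- by move=> _; exists (fun=> - 2).
- by rewrite bigcup_const//; exists 0%N.
- by move=> _ [a _ <-]; exact: EO.
- by move=> _; apply: (le_lt_trans (probability_le1 mu measurableT)); rewrite ltry.
Unshelve. all: by end_near. Qed.

End sphere_functions.

(** * Wasserstein distance and curves of measures *)

Section wasserstein_theory.
Context {R : realType} {n : nat}.
Notation V := 'cV[R]_n.+1.
Notation S := (sphere R n).
Implicit Types (mu nu : probability S R) (F : V -> R).

Lemma integral_marginal mu (pi : probability (S * S)%type R) (p : S * S -> S) F :
  measurable_fun setT p -> (forall A, measurable A -> pi (p @^-1` A) = mu A) ->
  cts_sphere F ->
  \int[mu]_x F (val x) = \int[pi]_z F (val (p z)) /\
  pi.-integrable setT (EFin \o (fun z => F (val (p z)))).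
Proof.
move=> mp piE cF; have [M M0 FM] := cts_bounded cF.
have mF := measurable_cts cF.
have mFp : measurable_fun setT (fun z => F (val (p z)) : measurableTypeR R).
  exact: (measurableT_comp mF mp).
have iFp : pi.-integrable setT (EFin \o (fun z => F (val (p z)))).
  apply: measurable_bounded_integrable => //.
    by apply: (le_lt_trans (probability_le1 pi measurableT)); rewrite ltry.
  exists M; split; first by rewrite num_real.
  by move=> N MN z _ /=; rewrite (le_trans (FM _ (enorm_val _)))// ltW.
split=> //; congr fine.
rewrite -[RHS](integral_pushforward (phi := p) (f := fun x => (F (val x))%:E)
  mp _ iFp measurableT); last exact/measurable_EFinP.
by apply: eq_measure_integral => A mA _; rewrite /= -piE.
Qed.

Lemma measurable_sphere_dist :
  measurable_fun setT (fun z : S * S => enorm (val z.1 - val z.2) : measurableTypeR R).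
Proof.
apply: (@measurableT_comp _ _ _ _ _ _ (fun v : bvec R n.+1 => enorm v) _
   (fun z : S * S => (val z.1 - val z.2 : bvec R n.+1))).
  exact: measurable_enorm.
apply: measurable_bvec => i.
rewrite (_ : (fun _ => _) = fun z : S * S =>
    (val z.1 : 'cV_n.+1) i ord0 - (val z.2 : 'cV_n.+1) i ord0); last first.
  by apply/funext => z; rewrite !mxE.
have mc : measurable_fun [set: S] (fun x => val x i ord0 : measurableTypeR R).
  by apply: (@measurable_cts R n (fun v => v i ord0)) => v _; exact: coord_continuous.
by apply: measurable_funB; [exact: (measurableT_comp mc)|exact: (measurableT_comp mc)].
Qed.

(** Since [W1] is an infimum, some coupling has cost below [d]; the modulus of [F] is integrated
    against it. *)
Lemma integral_W1_le mu nu F (e C d : R) : cts_sphere F -> 0 <= C ->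
  (forall v w : V, enorm v = 1 -> enorm w = 1 ->
    `|F v - F w| <= e + C * enorm (v - w)) ->
  (W1 mu nu < d%:E)%E ->
  `|\int[mu]_x F (val x) - \int[nu]_x F (val x)| <= e + C * d.
Proof.
move=> cF C0 FC /ereal_inf_lt[_ [pi [pi1 pi2] <-]] dE.
have [||E1 I1] := @integral_marginal mu pi fst F _ _ cF.
  exact: measurable_fst.
  by move=> A mA; rewrite -pi1// setXT.
have [||E2 I2] := @integral_marginal nu pi snd F _ _ cF.
  exact: measurable_snd.
  by move=> A mA; rewrite -pi2// setTX.
rewrite E1 E2 -RintegralB//.
have mD := measurable_sphere_dist.
have iD : pi.-integrable setT (EFin \o (fun z : S * S => enorm (val z.1 - val z.2))).
  apply/integrableP; split; first exact/measurable_EFinP.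
  rewrite (eq_integral (fun z : S * S => (enorm (val z.1 - val z.2))%:E)).
    by apply: (lt_trans dE); rewrite ltry.
  by move=> z _ /=; rewrite ger0_norm// enorm_ge0.
have ie : pi.-integrable setT (EFin \o (cst e)).
  apply: measurable_bounded_integrable => //.
    by apply: (le_lt_trans (probability_le1 pi measurableT)); rewrite ltry.
  exists `|e|; split; first by rewrite num_real.
  by move=> N eN z _ /=; exact: ltW.
have iCD : pi.-integrable setT (EFin \o (fun z : S * S => C * enorm (val z.1 - val z.2))).
  by have := integrableZl measurableT C iD.
have iB : pi.-integrable setT (EFin \o (fun z => F (val z.1) - F (val z.2))).
  by have := integrableB measurableT I1 I2.
rewrite (le_trans (le_normr_Rintegral _ iB))//.
apply: (@le_trans _ _ (\int[pi]_z (e + C * enorm (val z.1 - val z.2)))).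
  apply: le_Rintegral => //.
  - exact: integrable_norm.
  - by have := integrableD measurableT ie iCD.
  - by move=> z _; apply: FC; exact: enorm_val.
rewrite RintegralD// RintegralZl// Rintegral_cst//.
rewrite [X in fine X](_ : _ = 1%E) ?mulr1; last exact: probability_setT.
rewrite lerD2l ler_wpM2l// -lee_fin fineK ?ltW//.
exact: integrable_fin_num.
Qed.

Lemma W1_eq0 mu nu : mu ≡μ nu -> (W1 mu nu <= 0)%E.
Proof.
move=> E.
have mdiag : measurable_fun setT (fun x : S => (x, x)).
  exact: measurable_fun_pair.
pose g : {mfun S >-> (S * S)%type} :=
  HB.pack (fun x : S => (x, x)) (isMeasurableFun.Build _ _ _ _ _ mdiag).
apply: ereal_inf_lbound; exists (distribution mu g).
  split=> A mA; first by congr (mu _); apply/seteqP; split => x //= -[].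
  by rewrite -E//; congr (mu _); apply/seteqP; split => x //= -[].
rewrite ge0_integral_distribution//=; last 2 first.
- by apply/measurable_EFinP; exact: measurable_sphere_dist.
- by move=> z; rewrite lee_fin enorm_ge0.
by apply: integral0_eq => x _; rewrite /= subrr enorm0.
Qed.

Lemma coord_le_opnorm (A : 'M[R]_n.+1) i j : `|A i j| <= opnorm A.
Proof.
apply: (@le_trans _ _ (enorm (A *m delta_mx j ord0))).
  have := coord_le_enorm (A *m (delta_mx j ord0 : V)) i.
  by rewrite -colE mxE.
have e1 : usphere R n.+1 (delta_mx j ord0).
  rewrite /usphere/= /enorm (bigD1 j)//= big1 => [|i' i'j].
    by rewrite mxE !eqxx addr0 expr1n sqrtr1.
  by rewrite mxE (negbTE i'j) expr0n.
have cA : cts_sphere (fun v => enorm (A *m v)).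
  move=> v _; apply: (@continuous_comp _ _ _ (fun v : V => A *m v)).
    exact: mulmx_continuous.
  exact: enorm_continuous.
have [M M0 HM] := cts_bounded cA.
apply: sup_upper_bound.
  split; first by exists (enorm (A *m delta_mx j ord0)); exists (delta_mx j ord0).
  by exists M => _ [v v1 <-]; rewrite (le_trans (ler_norm _))// HM.
by exists (delta_mx j ord0).
Qed.

Variable Fm : probability S R -> 'M[R]_n.+1.
Variable L : R.
Hypothesis L0 : 0 <= L.
Hypothesis FmL : forall mu nu, ((opnorm (Fm mu - Fm nu))%:E <= L%:E * W1 mu nu)%E.

(** [≡μ] is agreement on measurable sets, not equality, so [Fm] could a priori tell the two apart.
    The diagonal coupling gives them distance zero and the Lipschitz bound concludes. *)
Lemma Lipschitz_measure_eq mu nu : mu ≡μ nu -> Fm mu = Fm nu.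
Proof.
move=> E; apply/matrixP => i j; apply/eqP; rewrite -subr_eq0 -normr_le0.
have := coord_le_opnorm (Fm mu - Fm nu) i j; rewrite mxE [X in _ + X]mxE => /le_trans; apply.
rewrite -lee_fin (le_trans (FmL _ _))//.
by rewrite mule_ge0_le0// W1_eq0.
Qed.

End wasserstein_theory.

(** * Integrals along a continuous curve of measures *)

Section curves_of_measures.
Context {R : realType} {n : nat}.
Notation V := 'cV[R]_n.+1.
Notation S := (sphere R n).
Variable rt : R -> probability S R.
Hypothesis near_W1 : forall (t e : R), 0 < e ->
  \forall s \near t, (W1 (rt s) (rt t) < e%:E)%E.

(** Two errors: the measure moves under the fixed integrand [Phi s], controlled by the modulus and
    [W1]; the integrand moves under the measure [rt t], controlled uniformly on the compact
    sphere. *)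
Lemma continuous_integral_curve (Phi : R -> V -> R) (s : R) :
  (forall v, enorm v = 1 -> {for (s, v), continuous (fun p : R * V => Phi p.1 p.2)}) ->
  (\forall t \near s, cts_sphere (Phi t)) ->
  {for s, continuous (fun t => \int[rt t]_x Phi t (val x))}.
Proof.
move=> cPhi ncts; apply/cvgrPdist_lt => e e0.
have cs : cts_sphere (Phi s) := nbhs_singleton ncts.
have e40 : 0 < e / 4 by rewrite divr_gt0.
have [C C0 HC] := cts_modulus cs e40.
(* The first error is at most e / 4 + C d < e / 2 and the second at most e / 4. Dividing by C + 1
   allows for C = 0. *)
pose d := e / 4 / (C + 1).
have C10 : 0 < C + 1 by rewrite ltr_wpDl.
have d0 : 0 < d by rewrite divr_gt0.
have Cd : C * d < e / 4.
  by rewrite /d mulrCA gtr_pMr// ltr_pdivrMr// mul1r ltrDl.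
have unif : \forall t \near s, usphere R n.+1 `<=`
    (fun v : V => `|Phi t v - Phi s v| <= e / 4).
  have /compact_near_coveringP/near_covering_withinP cK := @usphere_compact R n.+1.
  apply: (cK R (nbhs s) (fun t v => `|Phi t v - Phi s v| <= e / 4)) => v v1.
  have e80 : 0 < e / 4 / 2 by rewrite divr_gt0.
  have /cvgrPdist_lt/(_ _ e80)[[A B] /= [As Bv] AB] := cPhi v v1.
  exists (B, A) => //= -[w t] /= [Bw At] w1.
  have H1 := AB (t, w) (conj At Bw).
  have H2 := AB (s, w) (conj (nbhs_singleton As) Bw).
  rewrite -(subrKA (Phi s v)) (le_trans (ler_normD _ _))// (splitr (e / 4)).
  by rewrite lerD//; [rewrite distrC ltW|rewrite ltW].
near=> t.
have ct : cts_sphere (Phi t) by near: t.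
have cts : cts_sphere (fun v => Phi t v - Phi s v).
  by move=> v v1; exact: (continuousB (ct v v1) (cs v v1)).
rewrite -(subrKA (\int[rt t]_x Phi s (val x))) (le_lt_trans (ler_normD _ _))//.
have H1 : `|\int[rt s]_x Phi s (val x) - \int[rt t]_x Phi s (val x)| <= e / 4 + C * d.
  rewrite distrC; apply: (integral_W1_le cs C0 HC).
  by near: t; exact: near_W1.
have H2 : `|\int[rt t]_x Phi s (val x) - \int[rt t]_x Phi t (val x)| <= e / 4.
  rewrite distrC -RintegralB//; [|exact: integrable_cts..].
  apply: (le_normr_integral_cts (rt t) cts) => v v1.
  by move: v v1; near: t.
lra.
Unshelve. all: by end_near. Qed.

Lemma continuous_Lipschitz_curve (Fm : probability S R -> 'M[R]_n.+1) (L : R) :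
  0 <= L ->
  (forall mu nu, ((opnorm (Fm mu - Fm nu))%:E <= L%:E * W1 mu nu)%E) ->
  forall i j, continuous (fun t => Fm (rt t) i j).
Proof.
move=> L0 FmL i j t; apply/cvgrPdist_lt => e e0.
have L10 : 0 < L + 1 by rewrite ltr_wpDl.
have d0 : 0 < e / (L + 1) by rewrite divr_gt0.
near=> s.
have H : (W1 (rt s) (rt t) < (e / (L + 1))%:E)%E by near: s; exact: near_W1.
have := coord_le_opnorm (Fm (rt s) - Fm (rt t)) i j.
rewrite mxE [X in _ + X]mxE distrC => /le_lt_trans; apply.
rewrite -lte_fin (le_lt_trans (FmL _ _))//.
apply: (@le_lt_trans _ _ (L%:E * (e / (L + 1))%:E)%E).
  by rewrite lee_wpmul2l// ltW.
rewrite -EFinM lte_fin mulrCA gtr_pMr//.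
by rewrite ltr_pdivrMr// mul1r ltrDl.
Unshelve. all: by end_near. Qed.

End curves_of_measures.

Section slopes.
Context {R : realType}.

Lemma slopeP (f : R -> R) (t d : R) :
  ((s - t)^-1 * (f s - f t) @[s --> t^'] --> d) <-> is_derive t 1 f d.
Proof.
have E : (s - t)^-1 * (f s - f t) @[s --> t^'] =
    h^-1 *: ((f \o shift t) (h *: (1 : R)) - f t) @[h --> 0^'].
  have H A : (\forall s \near t^', A ((s - t)^-1 * (f s - f t))) =
      (\forall h \near 0^', A (h^-1 *: ((f \o shift t) (h *: (1 : R)) - f t))).
    rewrite /dnbhs !near_withinE.
    apply: (etrans (near_shift (0 : R) t (fun s => s != t -> A ((s - t)^-1 * (f s - f t))))).
    apply: eq_near => h /=; rewrite subr0 addrK -subr_eq0 addrK.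
    by rewrite /GRing.scale/= mulr1.
  by apply/funext => A; exact: H.
rewrite E; split => [H|[H <-]] //.
apply: DeriveDef; first by apply/cvg_ex; exists d.
exact: cvg_lim.
Qed.

End slopes.

Section difference_quotient.
Context {R : realType} {T : topologicalType}.

(** By the mean value theorem the difference quotient is a value of [u] at an intermediate time,
    hence close to u s v. *)
Lemma slope_continuous (f u : R -> T -> R) (s : R) (v : T) :
  (\forall p \near (s, v), is_derive (p.1 : R) 1 (f^~ p.2) (u p.1 p.2)) ->
  {for (s, v), continuous (fun p : R * T => u p.1 p.2)} ->
  {for (s, v), continuous (fun p : R * T =>
    if p.1 == s then u s p.2 else (p.1 - s)^-1 * (f p.1 p.2 - f s p.2))}.
Proof.
move=> df cu; apply/cvgrPdist_lt => e e0 /=.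
have [[A1 B1] /= [As1 Bv1] AB1] := df.
have /cvgrPdist_lt/(_ _ e0)[[A2 B2] /= [As2 Bv2] AB2] := cu.
have /nbhs_ballP[r /= r0 rA] : nbhs s (A1 `&` A2) by exact: filterI.
have rAs t : `|s - t| < r -> A1 t /\ A2 t by move=> st; apply: rA.
have rS : A1 s /\ A2 s by apply: rAs; rewrite subrr normr0.
exists (ball s r, B1 `&` B2) => /=.
  by split; [exact: nbhsx_ballx|exact: filterI].
move=> [t w] /= [rt [B1w B2w]]; rewrite eqxx.
have [_|ts] := eqVneq t s; first exact: (AB2 (s, w) (conj rS.2 B2w)).
have dfw c : `|s - c| < r -> is_derive c 1 (f^~ w) (u c w).
  by move=> /rAs[A1c _]; exact: (AB1 (c, w) (conj A1c B1w)).
have main c : `|s - c| < r -> `|u s v - u c w| < e.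
  by move=> /rAs[_ A2c]; exact: (AB2 (c, w) (conj A2c B2w)).
have mvt a b : a < b -> (forall c, a <= c <= b -> `|s - c| < r) ->
    exists2 c, `|s - c| < r & f b w - f a w = u c w * (b - a).
  move=> ab abr; have [c cab E] : exists2 c, c \in `]a, b[ & f b w - f a w = u c w * (b - a).
    apply: (@MVT R (f^~ w) (u^~ w)) => //.
      by move=> c; rewrite in_itv/= => /andP[ac cb]; apply: dfw; apply: abr; rewrite !ltW.
    apply: derivable_within_continuous => c; rewrite in_itv/= => /abr/dfw.
    by case.
  exists c => //; apply: abr; move: cab; rewrite in_itv/= => /andP[ac cb].
  by rewrite !ltW.
have rt' : `|s - t| < r := rt.
move: rt'; rewrite ltr_norml => /andP[r1 r2].
have [st|ts'|//] := ltgtP s t; last by move=> st; rewrite st eqxx in ts.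
  have [|c cr ->] := mvt s t st.
    by move=> c /andP[sc ct]; rewrite ltr_norml; apply/andP; split; lra.
  by rewrite mulrCA mulVf ?mulr1 ?subr_eq0//; exact: main.
have [|c cr E] := mvt t s ts'.
  by move=> c /andP[sc ct]; rewrite ltr_norml; apply/andP; split; lra.
rewrite -(opprB (f s w)) E -(opprB s t) invrN mulrNN mulrCA mulVf ?mulr1 ?subr_eq0 1?eq_sym//.
exact: main.
Qed.

End difference_quotient.

Section derivative_of_integral.
Context {R : realType} {n : nat}.
Notation V := 'cV[R]_n.+1.
Notation S := (sphere R n).
Variable rt : R -> probability S R.
Hypothesis near_W1 : forall (t e : R), 0 < e ->
  \forall s \near t, (W1 (rt s) (rt t) < e%:E)%E.

(** Leibniz rule for integrand and measure moving together. The quotient of f, completed by [u s] at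
    t = s, is [Phi], whose integral against [rt t] is continuous in t; the increment of the measure
    under the fixed [f s] contributes [k]. *)
Lemma is_derive_integral_curve (f u : R -> V -> R) (s k : R) :
  (\forall t \near s, cts_sphere (f t)) -> cts_sphere (u s) ->
  (forall v, enorm v = 1 ->
    \forall p \near (s, v), is_derive (p.1 : R) 1 (f^~ p.2) (u p.1 p.2)) ->
  (forall v, enorm v = 1 -> {for (s, v), continuous (fun p : R * V => u p.1 p.2)}) ->
  is_derive s 1 (fun t => \int[rt t]_x f s (val x)) k ->
  is_derive s 1 (fun t => \int[rt t]_x f t (val x))
    (\int[rt s]_x u s (val x) + k).
Proof.
move=> ctf ctu df cu /slopeP dk; apply/slopeP.
pose Phi t v := if t == s then u s v else (t - s)^-1 * (f t v - f s v).
have cfs := nbhs_singleton ctf.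
have cPhi t : cts_sphere (f t) -> cts_sphere (Phi t).
  move=> cft v v1; rewrite /Phi; have [_|_] := eqVneq t s; first exact: ctu.
  apply: continuousM; first exact: cst_continuous.
  exact: (continuousB (cft v v1) (cfs v v1)).
have cI : {for s, continuous (fun t => \int[rt t]_x Phi t (val x))}.
  apply: continuous_integral_curve => //.
    by move=> v v1; exact: (slope_continuous (df v v1) (cu v v1)).
  by apply: filterS ctf; exact: cPhi.
have E : \int[rt s]_x u s (val x) = \int[rt s]_x Phi s (val x).
  by apply: eq_Rintegral => x _; rewrite /Phi eqxx.
have cI' : (\int[rt t]_x Phi t (val x)) @[t --> s^'] --> \int[rt s]_x Phi s (val x).
  by apply: cvg_trans cI; apply: cvg_app; exact: cvg_within.
rewrite E; apply: cvg_trans (@cvgD R R^o _ _ _ _ _ _ _ cI' dk); apply: near_eq_cvg.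
have nctf : \forall t \near s^', cts_sphere (f t).
  by rewrite /dnbhs near_withinE; apply: filterS ctf => t ct _.
near=> t.
have ts : t != s by near: t; exact: nbhs_dnbhs_neq.
have cft : cts_sphere (f t) by near: t.
have PhiE : \int[rt t]_x Phi t (val x) =
    (t - s)^-1 * (\int[rt t]_x f t (val x) - \int[rt t]_x f s (val x)).
  rewrite -RintegralB//; [|exact: integrable_cts..].
  rewrite -RintegralZl//; last first.
    have cB : cts_sphere (fun v => f t v - f s v).
      by move=> v v1; exact: (continuousB (cft v v1) (cfs v v1)).
    exact: (integrable_cts _ cB).
  by apply: eq_Rintegral => x _; rewrite /Phi (negbTE ts).
transitivity (\int[rt t]_x Phi t (val x) +
  (t - s)^-1 * (\int[rt t]_x f s (val x) - \int[rt s]_x f s (val x))) => //.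
by rewrite PhiE -mulrDr addrA subrK.
Unshelve. all: by end_near. Qed.

End derivative_of_integral.

Lemma mulmx_neq0 (R : realType) n (M : 'M[R]_n) (v : 'cV[R]_n) :
  M \in unitmx -> v != 0 -> M *m v != 0.
Proof.
move=> uM; apply: contra_neq => Mv.
by rewrite -[v]mul1mx -(mulVmx uM) -mulmxA Mv mulmx0.
Qed.

Lemma continuous_pair (T U W : topologicalType) (g : T * U -> W) (t : T) (v : U) :
  {for (t, v), continuous g} -> {for v, continuous (fun w => g (t, w))}.
Proof.
move=> cg A /cg[[B C] [Bt Cv] BC]; apply: filterS Cv => w Cw.
exact: (BC (t, w) (conj (nbhs_singleton Bt) Cw)).
Qed.

(** * Radial extensions composed with linear maps *)

Section radial_gradient.
Context {R : realType} {n : nat}.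
Notation V := 'cV[R]_n.+1.
Notation S := (sphere R n).
Implicit Types (phi : S -> R) (M : 'M[R]_n.+1) (v : V).

Lemma radial_ext_mulmx phi M v : v != 0 ->
  radial_ext (fun x => phi (normalize (M *m val x))) v = radial_ext phi (M *m v).
Proof. by move=> v0; rewrite /radial_ext normalize_mul. Qed.

Lemma grad_radial_ext_mulmx phi M v : C1_sphere phi -> M \in unitmx -> v != 0 ->
  grad (radial_ext (fun x => phi (normalize (M *m val x)))) v =
  M^T *m grad (radial_ext phi) (M *m v).
Proof.
move=> C uM v0; have [d _] := C _ (mulmx_neq0 uM v0).
rewrite -(grad_mulmx d); apply: near_eq_grad.
by apply: filterS (near_neq0 v0) => y y0; exact: radial_ext_mulmx.
Qed.

Lemma C1_sphere_mulmx phi M : C1_sphere phi -> M \in unitmx ->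
  C1_sphere (fun x => phi (normalize (M *m val x))).
Proof.
move=> C uM v v0; have [d cg] := C _ (mulmx_neq0 uM v0); split.
  apply: (@near_eq_differentiable _ _ _ (fun y => radial_ext phi (M *m y))).
    by apply: filterS (near_neq0 v0) => y y0; rewrite radial_ext_mulmx.
  apply: (@differentiable_comp _ _ _ _ (mulmx M) (radial_ext phi)) => //.
  exact: differentiable_mulmx.
apply: (@near_eq_continuous _ _ (fun y => M^T *m grad (radial_ext phi) (M *m y))).
  by apply: filterS (near_neq0 v0) => y y0; rewrite grad_radial_ext_mulmx.
apply: (@continuous_comp _ _ _ (fun y => grad (radial_ext phi) (M *m y)) (mulmx M^T)).
  by apply: continuous_comp; [exact: mulmx_continuous|exact: cg].
exact: mulmx_continuous.
Qed.

(** The radial extension is constant along s |-> (1 + s) v near s = 0. *)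
Lemma grad_radial_ext_tangent phi v : C1_sphere phi -> v != 0 ->
  ((grad (radial_ext phi) v)^T *m v) = 0.
Proof.
move=> C v0; have [d _] := C _ v0.
pose c (t : R) : V := (1 + t) *: v.
have c0 : c 0 = v by rewrite /c addr0 scale1r.
have dc i : is_derive (0 : R) 1 (fun s => c s i ord0) (v i ord0).
  rewrite (_ : (fun s => _) = fun s => (1 + s) * v i ord0); last first.
    by apply/funext => s; rewrite mxE.
  have d1 : is_derive (0 : R) 1 (fun s : R => 1 + s) 1.
    have := is_deriveD (is_derive_cst (1 : R) (0 : R) 1) (is_derive_id (0 : R) 1).
    by rewrite add0r => d1'; exact: d1'.
  by apply: (is_derive_eq (is_derive_mulr (v i ord0) d1)); rewrite mul1r.
rewrite -c0 in d; have := is_derive_curve dc d; rewrite c0 => D.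
have D0 : is_derive (0 : R) 1 (fun s : R => radial_ext phi (c s)) 0.
  apply: (@near_eq_is_derive _ _ _ (cst (radial_ext phi v))).
    near=> s; rewrite /radial_ext normalizeZ//.
    suff : - 1 < s by lra.
    near: s; apply: lt_nbhsr; lra.
apply/matrixP => i j; rewrite (ord1 i) (ord1 j) [RHS]mxE.
by move: (@derive_val _ _ _ _ _ _ _ D) => <-; exact: (@derive_val _ _ _ _ _ _ _ D0).
Unshelve. all: by end_near. Qed.

Lemma radial_ext_joint (T : topologicalType) (M : T -> 'M[R]_n.+1) (t : T) phi v :
  C1_sphere phi -> M t \in unitmx -> v != 0 -> {for t, continuous M} ->
  {for (t, v), continuous (fun p : T * V => grad (radial_ext phi) (M p.1 *m p.2))}.
Proof.
move=> C uM v0 cM; have [_ cg] := C _ (mulmx_neq0 uM v0).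
apply: (@continuous_comp _ _ _ (fun p : T * V => M p.1 *m p.2) (grad (radial_ext phi))).
  apply: cvg_mulmx; last exact: cvg_snd.
  by apply: (@continuous_comp _ _ _ fst M); [exact: cvg_fst|exact: cM].
exact: cg.
Qed.

End radial_gradient.

(** * Transport along the flow *)

Section mean_field_flow.
Context {R : realType} {n : nat}.
Notation V := 'cV[R]_n.+1.
Notation S := (sphere R n).
Variables (F : probability S R -> 'M[R]_n.+1) (rt : R -> probability S R).
Hypothesis near_W1 : forall (t e : R), 0 < e ->
  \forall s \near t, (W1 (rt s) (rt t) < e%:E)%E.
Hypothesis Frt_continuous : forall i j, continuous (fun t => F (rt t) i j).
Hypothesis weak : forall phi : S -> R, C1_sphere phi -> forall t, 0 <= t ->
  \int[rt t]_x phi x - \int[rt 0]_x phi x =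
  \int[lebesgue_measure]_(s in `[0, t]) (\int[rt s]_x
    ((sphere_grad phi x)^T *m drift F (val x) (rt s)) ord0 ord0).

Lemma continuous_mxE (g : R -> 'M[R]_n.+1) t :
  (forall i j, {for t, continuous (fun s => g s i j)}) -> {for t, continuous g}.
Proof. by move=> cg; apply: mx_cvg => i j; exact: cg. Qed.

Lemma drift_joint t v :
  {for (t, v), continuous (fun p : R * V => drift F p.2 (rt p.1))}.
Proof.
have c2 : (p.2 @[p --> (t, v)]) --> v by exact: cvg_snd.
apply: cvg_mulmx; last exact: c2.
apply: cvg_mulmx.
  have cxx : (p.2 *m p.2^T @[p --> ((t, v) : R * V)]) --> v *m v^T.
    by apply: cvg_mulmx => //; exact: cvg_trmx.
  by apply: cvgB; [exact: cvg_cst|exact: cxx].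
apply: (@continuous_comp _ _ _ (@fst R V) (fun s => F (rt s))); first exact: cvg_fst.
by apply: continuous_mxE => i j; exact: Frt_continuous.
Qed.

(** The inner integral is continuous in time, so the fundamental theorem of calculus turns the weak
    formulation into a pointwise derivative. *)
Lemma is_derive_weak (phi : S -> R) (s : R) : C1_sphere phi -> 0 < s ->
  is_derive s 1 (fun t => \int[rt t]_x phi x)
    (\int[rt s]_x ((sphere_grad phi x)^T *m drift F (val x) (rt s)) ord0 ord0).
Proof.
move=> C s0.
pose Phi (r : R) (v : V) := ((grad (radial_ext phi) v)^T *m drift F v (rt r)) ord0 ord0.
have cPhi r v : v != 0 -> {for (r, v), continuous (fun p : R * V => Phi p.1 p.2)}.
  move=> v0; apply: cvg_coord; apply: cvg_mulmx; last exact: drift_joint.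
  apply: cvg_trmx; have [_ cg] := C _ v0.
  apply: (@continuous_comp _ _ _ (@snd R V) (grad (radial_ext phi))).
    exact: cvg_snd.
  exact: cg.
have v0 (v : V) : enorm v = 1 -> v != 0 by rewrite -enorm_eq0 => ->; exact: oner_neq0.
have cK : continuous (fun r => \int[rt r]_x Phi r (val x)).
  move=> r; apply: (continuous_integral_curve near_W1).
    by move=> v v1; apply: cPhi; exact: v0.
  near=> q; move=> v v1.
  exact: (continuous_pair (cPhi q v (v0 v v1))).
have D := is_derive_Rintegral cK s0.
have D' : is_derive s 1 (fun t => \int[rt 0]_x phi x +
    \int[lebesgue_measure]_(r in `[0, t]) \int[rt r]_x Phi r (val x))
    (\int[rt s]_x Phi s (val x)).
  by apply: (is_derive_eq (is_deriveD (is_derive_cst _ s 1) D)); rewrite add0r.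
apply: near_eq_is_derive D'; near=> t.
by rewrite -weak ?subrKC//; near: t; apply: (filterS _ (lt_nbhsr s0)) => t /ltW.
Unshelve. all: by end_near. Qed.

Section pullback.
Variables (H : R -> 'M[R]_n.+1) (a : R) (phi : S -> R).
Hypothesis a0 : a < 0.
Hypothesis unitH : forall t, a < t -> H t \in unitmx.
Hypothesis dH : forall t, a < t -> forall i j,
  is_derive t 1 (fun s => H s i j) ((- (H t *m F (rt t))) i j).
Hypothesis C1phi : C1_sphere phi.

(** As H' = - H F, the vector H t v_t is constant along v' = F v, so [psi] is constant along
    trajectories; [dpsi] is its time derivative at fixed [v]. *)
Let psi (t : R) (v : V) := radial_ext phi (H t *m v).
Let dpsi (t : R) (v : V) :=
  ((grad (radial_ext phi) (H t *m v))^T *m (- (H t *m F (rt t)) *m v)) ord0 ord0.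

Let unit_neq0 (v : V) : enorm v = 1 -> v != 0.
Proof. by rewrite -enorm_eq0 => ->; exact: oner_neq0. Qed.

Let continuousH t : a < t -> {for t, continuous H}.
Proof.
by move=> at_; apply: continuous_mxE => i j; apply: is_derive_continuous (dH at_ i j).
Qed.

Let psi_joint t v : a < t -> v != 0 ->
  {for (t, v), continuous (fun p : R * V => psi p.1 p.2)}.
Proof.
move=> at_ v0; have [/differentiable_continuous cphi _] := C1phi (mulmx_neq0 (unitH at_) v0).
apply: (@continuous_comp _ _ _ (fun p : R * V => H p.1 *m p.2) (radial_ext phi)); last exact: cphi.
apply: cvg_mulmx; last exact: cvg_snd.
by apply: (@continuous_comp _ _ _ (@fst R V) H); [exact: cvg_fst|exact: continuousH].
Qed.

Let dpsi_joint t v : a < t -> v != 0 ->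
  {for (t, v), continuous (fun p : R * V => dpsi p.1 p.2)}.
Proof.
move=> at_ v0; apply: cvg_coord; apply: cvg_mulmx.
  apply: cvg_trmx; exact: (radial_ext_joint C1phi (unitH at_) v0 (continuousH at_)).
apply: cvg_mulmx; last exact: cvg_snd.
have cHF : {for t, continuous (fun s => - (H s *m F (rt s)))}.
  apply: cvgN; apply: cvg_mulmx; first exact: continuousH.
  by apply: continuous_mxE => i j; exact: Frt_continuous.
by apply: (@continuous_comp _ _ _ (@fst R V) (fun s => - (H s *m F (rt s))));
  [exact: cvg_fst|exact: cHF].
Qed.

Let is_derive_psi t v : a < t -> v != 0 ->
  is_derive t 1 (psi^~ v) (dpsi t v).
Proof.
move=> at_ v0; apply: is_derive_curve; last first.
  by have [] := C1phi (mulmx_neq0 (unitH at_) v0).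
move=> i; rewrite -[v]/((fun=> v) t).
apply: (is_derive_eq (@is_derive_mulmx _ _ _ _ H (fun=> v) _ 0 t (dH at_) _ i ord0)).
  by move=> k l; rewrite [X in is_derive _ _ _ X]mxE; exact: is_derive_cst.
by rewrite mulmx0 addr0.
Qed.

Let cts_psi t : a < t -> cts_sphere (psi t).
Proof.
move=> at_ v v1.
exact: (continuous_pair (psi_joint at_ (unit_neq0 v1))).
Qed.

Let cts_dpsi t : a < t -> cts_sphere (dpsi t).
Proof.
move=> at_ v v1.
exact: (continuous_pair (dpsi_joint at_ (unit_neq0 v1))).
Qed.

(* By Euler's identity for 0-homogeneous functions, the normal part of the drift
   does not contribute. *)
Let dpsiE t (x : S) : a < t ->
  ((sphere_grad (fun y => phi (normalize (H t *m val y))) x)^T *m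
    drift F (val x) (rt t)) ord0 ord0 = - dpsi t (val x).
Proof.
move=> at_; have uH := unitH at_; have x0 := val_neq0 x.
rewrite /sphere_grad /drift mulmxA mulmxA mulmxBr mulmx1 mulmxA.
rewrite (grad_radial_ext_tangent (C1_sphere_mulmx C1phi uH) x0).
rewrite mul0mx subr0 (grad_radial_ext_mulmx C1phi uH x0) trmx_mul trmxK /dpsi.
by rewrite mulNmx mulmxN [in RHS]mxE opprK !mulmxA.
Qed.

Lemma is_derive_pullback (t : R) : 0 < t ->
  is_derive t 1 (fun s => \int[rt s]_x psi s (val x)) 0.
Proof.
move=> t0; have at_ : a < t := lt_trans a0 t0.
have E : (fun s => \int[rt s]_x psi t (val x)) =
    fun s => \int[rt s]_x phi (normalize (H t *m val x)) by [].
have D := is_derive_weak (C1_sphere_mulmx C1phi (unitH at_)) t0.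
rewrite -E in D.
have nt := lt_nbhsr at_.
apply: (is_derive_eq (is_derive_integral_curve near_W1 _ (cts_dpsi at_) _ _ D)).
- by apply: filterS nt => s; exact: cts_psi.
- move=> v /unit_neq0 v0; exists ([set s | a < s], [set w : V | w != 0]) => /=.
    by split; [exact: nt|exact: near_neq0].
  by move=> [s w] /= [as_ w0]; exact: is_derive_psi.
- by move=> v /unit_neq0 v0; exact: dpsi_joint.
rewrite -RintegralD//; last 2 first.
  exact: integrable_cts (cts_dpsi at_).
  have -> : (fun x : S => ((sphere_grad (fun y => phi (normalize (H t *m val y))) x)^T *m
    drift F (val x) (rt t)) ord0 ord0) = fun x => - dpsi t (val x).
    by apply/funext => x; rewrite dpsiE.
  apply: (@integrable_cts _ _ _ (fun v => - dpsi t v)) => v v1.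
  by apply: continuousN; exact: cts_dpsi.
rewrite (@eq_Rintegral _ _ _ _ _ (cst 0)) ?Rintegral_cst ?mul0r//.
by move=> x _; rewrite dpsiE// subrr.
Qed.

Lemma pullback_constant t : 0 <= t ->
  \int[rt t]_x phi (normalize (H t *m val x)) =
  \int[rt 0]_x phi (normalize (H 0 *m val x)).
Proof.
move=> t0; pose h s := \int[rt s]_x psi s (val x).
(* [H] is controlled only after [a], and [is_derive_eq0_cst] asks for continuity on the whole line,
   hence the clamping of time at 0. *)
suff H1 : h (Num.max t 0) = h (Num.max 0 0).
  by move: H1; rewrite max_l// maxxx.
apply: (@is_derive_eq0_cst _ (fun s => h (Num.max s 0)) 0) => //.
  move=> s; apply: (@continuous_comp _ _ _ (fun s : R => Num.max s 0) h).
    by apply: (@continuous_max R _ id (cst 0)); [exact: cvg_id|exact: cvg_cst].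
  have as_ : a < Num.max s 0 by rewrite lt_max a0 orbT.
  apply: (continuous_integral_curve near_W1).
    by move=> v /unit_neq0 v0; exact: psi_joint.
  by apply: (filterS _ (lt_nbhsr as_)) => r; exact: cts_psi.
move=> s s0; apply: near_eq_is_derive (is_derive_pullback s0).
by apply: (filterS _ (lt_nbhsr s0)) => r r0; rewrite max_l// ltW.
Qed.

End pullback.
End mean_field_flow.

Lemma Rintegral_ACG_mul (R : realType) n (S G : 'M[R]_n.+1) (f : sphere R n -> R) :
  S^T = S -> (forall x, x != 0 -> 0 < qform S x) -> G \in unitmx ->
  measurable_fun setT (f : sphere R n -> measurableTypeR R) ->
  \int[ACG (G *m S *m G^T)]_x f x = \int[ACG S]_x f (normalize (G *m val x)).
Proof.
move=> ST Sp uG mf; rewrite /Rintegral; apply: (congr1 fine).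
have mf' : measurable_fun setT (EFin \o f) by exact/measurable_EFinP.
apply: (etrans (integralE _ _ _)); apply: (etrans _ (esym (integralE _ _ _))).
apply: (congr2 (fun a b => a - b)%E).
  apply: (etrans (ACG_mul ST Sp uG (measurable_funepos mf') (fun x => funepos_ge0 _ x))).
  by apply: eq_integral => x _; rewrite !funeposE.
apply: (etrans (ACG_mul ST Sp uG (measurable_funeneg mf') (fun x => funeneg_ge0 _ x))).
by apply: eq_integral => x _; rewrite !funenegE.
Qed.

Lemma SPD1_congruence (R : realType) n (K S : 'M[R]_n) :
  SPD1 S -> \det K = 1 -> SPD1 (K *m S *m K^T).
Proof.
move=> [ST Sp Sd] Kd; split.
- by rewrite !trmx_mul trmxK ST mulmxA.
- move=> x x0.
  have uK : K^T \in unitmx by rewrite unitmxE det_tr Kd unitr1.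
  have := Sp _ (mulmx_neq0 uK x0); rewrite /qform trmx_mul trmxK !mulmxA; exact.
- by rewrite !det_mulmx det_tr Kd Sd !mul1r.
Qed.

Section flow_of_weak_solution.
Context {R : realType} {n : nat}.
Notation S := (sphere R n).
Implicit Types rho : R -> probability S R.

(** [W1_continuous] uses neighbourhoods restricted to s >= 0; as max s 0 always satisfies the
    restriction, clamping turns them into full ones. *)
Lemma W1_continuous_extension rho : W1_continuous rho ->
  forall t e : R, 0 < e -> \forall s \near t,
    (W1 (rho (Num.max s 0)%R) (rho (Num.max t 0)%R) < e%:E)%E.
Proof.
move=> crho t e e0.
have m0 (s : R) : 0 <= Num.max s 0 by rewrite le_max lexx orbT.
have ne : nbhs (0%E : \bar R) [set x : \bar R | (x < e%:E)%E].
  exists e => //= r /=; rewrite sub0r normrN lte_fin.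
  exact: (le_lt_trans (ler_norm _)).
have /(_ _ ne) := crho _ (m0 t); rewrite /nbhs/= => H.
have cm : {for t, continuous (fun s : R => Num.max s 0)}.
  by apply: (@continuous_max R _ id (cst 0)); [exact: cvg_id|exact: cvg_cst].
have H' : \forall s \near t,
    0 <= Num.max s 0 -> (W1 (rho (Num.max s 0)%R) (rho (Num.max t 0)%R) < e%:E)%E.
  exact: (cm [set s : R | 0 <= s -> (W1 (rho s) (rho (Num.max t 0)%R) < e%:E)%E] H).
by apply: filterS H' => s; exact.
Qed.

Lemma is_derive_congruence (K : R -> 'M[R]_n) (S0 A : 'M[R]_n) (t : R) :
  (forall i j, is_derive t 1 (fun s => K s i j) ((A *m K t) i j)) ->
  forall i j, is_derive t 1 (fun s => (K s *m S0 *m (K s)^T) i j)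
    ((A *m (K t *m S0 *m (K t)^T) + (K t *m S0 *m (K t)^T) *m A^T) i j).
Proof.
move=> dK i j.
have dKS : forall i j, is_derive t 1 (fun s => (K s *m S0) i j) ((A *m K t *m S0) i j).
  move=> k l.
  apply: (is_derive_eq (@is_derive_mulmx _ _ _ _ K (fun=> S0) _ 0 t dK _ k l)).
    by move=> p q; rewrite [X in is_derive _ _ _ X]mxE; exact: is_derive_cst.
  by rewrite mulmx0 addr0.
have dKT : forall i j, is_derive t 1 (fun s => (K s)^T i j) (((A *m K t)^T) i j).
  move=> k l; rewrite mxE (_ : (fun s => _) = fun s => K s l k); first exact: dK.
  by apply/funext => s; rewrite mxE.
apply: (is_derive_eq (is_derive_mulmx dKS dKT i j)).
by rewrite trmx_mul !mulmxA.
Qed.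

Lemma is_derive_mx_slope (M : R -> 'M[R]_n) (dM : 'M[R]_n) (t : R) :
  (forall i j, is_derive t 1 (fun s => M s i j) (dM i j)) ->
  (s - t)^-1 *: (M s - M t) @[s --> t^'] --> dM.
Proof.
move=> dMP; apply: mx_cvg => i j.
have /slopeP := dMP i j; apply: cvg_trans; apply: near_eq_cvg.
by near=> s; rewrite !mxE.
Unshelve. all: by end_near. Qed.

End flow_of_weak_solution.

Theorem theorem3p9 (R : realType) (n : nat)
    (F : probability (sphere R n) R -> 'M[R]_n.+1) (L : R) (hL : 0 <= L)
    (hLip : forall mu nu : probability (sphere R n) R,
      ((opnorm (F mu - F nu))%:E <= L%:E * W1 mu nu)%E)
    (htr : forall mu : probability (sphere R n) R, \tr (F mu) = 0)
    (Sigma0 : 'M[R]_n.+1) (hSigma0 : SPD1 Sigma0)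
    (rho : R -> probability (sphere R n) R)
    (hrho : weak_solution F (ACG Sigma0) rho) :
  exists Sigma : R -> 'M[R]_n.+1,
    [/\ forall t, 0 <= t -> SPD1 (Sigma t),
        Sigma 0 = Sigma0,
        ACG_ode F Sigma &
        forall t, 0 <= t -> rho t ≡μ ACG (Sigma t)].
Proof.
have [crho rho0 weak] := hrho.
have [S0T S0p _] := hSigma0.
pose rt (t : R) := rho (Num.max t 0).
have rtE t : 0 <= t -> rt t = rho t by move=> t0; rewrite /rt max_l.
have near_W1 : forall t e : R, 0 < e -> \forall s \near t, (W1 (rt s) (rt t) < e%:E)%E.
  exact: W1_continuous_extension crho.
have cF : forall i j, continuous (fun t => F (rt t) i j).
  exact: (continuous_Lipschitz_curve near_W1 hL hLip).
have ae0 (f : sphere R n -> R) : \int[rt 0]_x f x = \int[ACG Sigma0]_x f x.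
  rewrite /Rintegral; apply: (congr1 fine); rewrite (rtE 0)//.
  by apply: eq_measure_integral => A mA _; exact: rho0.
have weak_rt : forall phi : sphere R n -> R, C1_sphere phi -> forall t, 0 <= t ->
    \int[rt t]_x phi x - \int[rt 0]_x phi x =
    \int[lebesgue_measure]_(s in `[0, t]) (\int[rt s]_x
      ((sphere_grad phi x)^T *m drift F (val x) (rt s)) ord0 ord0).
  move=> phi C t t0; rewrite ae0 (rtE t t0) (weak phi C t t0).
  apply: eq_Rintegral => s; rewrite inE/= in_itv/= => /andP[s0 _].
  by rewrite rtE.
have trF t : \tr (F (rt t)) = 0 by exact: htr.
(* starting at -1 makes t = 0 an interior point of the time interval *)
have [G [H [HG detG dG dH]]] := fundamental_matrix (-1) cF trF.
have N10 : -1 < 0 :> R by rewrite ltrN10.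
have GH t : -1 <= t -> G t *m H t = 1%:M by move=> t1; apply: mulmx1C; exact: HG.
have uG t : -1 <= t -> G t \in unitmx by move=> t1; rewrite unitmxE detG ?unitr1.
have uH t : -1 < t -> H t \in unitmx.
  by move=> t1; have /mulmx1_unit[] := HG t (ltW t1).
(* [H 0] inverts [G 0], so [K] is the flow that is the identity at time 0. *)
pose K t := G t *m H 0.
have detK t : -1 <= t -> \det (K t) = 1.
  move=> t1; rewrite det_mulmx detG// mul1r.
  have := congr1 determinant (HG 0 (ltW N10)).
  by rewrite det_mulmx det1 detG ?mulr1// ltW.
have uK t : -1 <= t -> K t \in unitmx by move=> t1; rewrite unitmxE detK ?unitr1.
have rtACG t : 0 <= t -> rt t ≡μ ACG (K t *m Sigma0 *m (K t)^T).
  move=> t0; have t1 : -1 <= t by rewrite (le_trans (ltW N10)).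
  apply: C1_sphere_determines => phi C.
  rewrite (Rintegral_ACG_mul S0T S0p (uK t t1)); last exact: measurable_C1_sphere.
  rewrite -ae0.
  (* With [t] fixed, the constancy is applied to [phi] composed with the action of [G t]: at time t
     the product G t H t cancels and leaves [phi], at time 0 the matrix G t H 0 = [K t] appears. *)
  have := pullback_constant near_W1 cF weak_rt N10 uH dH (C1_sphere_mulmx C (uG t t1)) t0.
  have E (M : 'M[R]_n.+1) (x : sphere R n) : M \in unitmx ->
      normalize (G t *m val (normalize (M *m val x))) = normalize (G t *m M *m val x).
    by move=> uM; rewrite normalize_mul ?mulmxA//; exact: (mulmx_neq0 uM (val_neq0 x)).
  rewrite [X in X = _](_ : _ = \int[rt t]_x phi x); last first.
    apply: eq_Rintegral => x _; rewrite E ?GH ?mul1mx ?normalize_val//.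
    by apply: uH; rewrite (lt_le_trans N10).
  move=> ->; apply: eq_Rintegral => x _; rewrite E//.
  exact: uH.
exists (fun t => K t *m Sigma0 *m (K t)^T); split.
- move=> t t0; apply: SPD1_congruence => //; apply: detK.
  by rewrite (le_trans (ltW N10)).
- by rewrite /K GH ?(ltW N10)// mul1mx trmx1 mulmx1.
- move=> t t0; have t1 : -1 < t by rewrite (lt_le_trans N10).
  (* The equation asks for [F] at ACG (Sigma t), while the flow was built with [F (rt t)]; the two
     values agree. *)
  rewrite -(Lipschitz_measure_eq hL hLip (rtACG t t0)).
  apply: (@cvg_trans _ ((s - t)^-1 *:
    (K s *m Sigma0 *m (K s)^T - K t *m Sigma0 *m (K t)^T) @[s --> t^'])).
    by apply: cvg_app; exact: cvg_within.
  apply: is_derive_mx_slope; apply: is_derive_congruence => i j.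
  apply: (is_derive_eq (@is_derive_mulmx _ _ _ _ G (fun=> H 0) _ 0 t (dG t t1) _ i j)).
    by move=> k l; rewrite [X in is_derive _ _ _ X]mxE; exact: is_derive_cst.
  by rewrite mulmx0 addr0 mulmxA.
- by move=> t t0; rewrite -(rtE t t0); exact: rtACG.
Qed.
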